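(* Let $L>0$ and let $D\subset\mathbb{H}^2$ be (the interior of) an equilateral triangle in the hyperbolic plane with side lengths $L$. If $F\colon D\to\mathbb{R}$ is a $\theta$-barrier for $D$, then $\theta \geq \frac{L}{12}-\frac{1}{6}$.
   Context: $\mathbb{H}^2$ is the hyperbolic plane: the complete simply connected Riemannian 2-manifold of constant sectional curvature $-1$, with metric $\langle\cdot,\cdot\rangle$ and distance $d$. An equilateral triangle with side lengths $L$ is the geodesic convex hull of three points of $\mathbb{H}^2$ at pairwise distance $L$. A set $D\subseteq \mathbb{H}^2$ is geodesically convex (g-convex) if for all $p,q\in D$ the geodesic segment from $p$ to $q$ lies in $D$. Barriers. Let $D\subseteq\mathbb{H}^2$ be open and g-convex. For a three times continuously differentiable $F\colon D\to\mathbb{R}$, let $\nabla F(p)\in T_p\mathbb{H}^2$ be the Riemannian gradient, $(\nabla^2F)_p$ the Riemannian Hessian (a symmetric bilinear form on $T_p\mathbb{H}^2$), and $(\nabla^3F)_p$ the third covariant derivative, i.e. the covariant derivative of the Hessian (a trilinear form, in general not symmetric). $F$ is strongly $1$-self-concordant if for all $p\in D$ and $u,v,w\in T_p\mathbb{H}^2$, $$|(\nabla^3F)_p(u,v,w)|\le 2\sqrt{(\nabla^2F)_p(u,u)}\sqrt{(\nabla^2F)_p(v,v)}\sqrt{(\nabla^2F)_p(w,w)},$$ and the epigraph $\{(p,t): p\in D,\ t\ge F(p)\}$ is a closed subset of $\mathbb{H}^2\times\mathbb{R}$. For a finite real number $\theta\ge 0$, $F$ is a $\theta$-barrier for $D$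 if it is strongly $1$-self-concordant, $(\nabla^2F)_p\succ0$ for all $p\in D$, and $\max_{0\neq v\in T_p\mathbb{H}^2}\frac{\langle\nabla F(p),v\rangle}{\sqrt{(\nabla^2F)_p(v,v)}}\le\sqrt\theta$ for all $p\in D$. *)

(* Defs.v *)
From Stdlib Require Import Reals.
From Coquelicot Require Import Coquelicot.

Open Scope R_scope.

(* The hyperbolic plane is the upper half-plane {(x,y) | y > 0} with the metric
   (dx^2 + dy^2) / y^2.  The coordinate fields identify every tangent space with
   R * R.  The set [H2] is open in R * R and the manifold topology is the subspace
   topology. *)

Definition H2 (p : R * R) : Prop := 0 < snd p.

Inductive idx : Set := I1 | I2.

Definition sum2 (f : idx -> R) : R := f I1 + f I2.

Definition coord (i : idx) (u : R * R) : R :=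
  match i with I1 => fst u | I2 => snd u end.

Definition delta (i j : idx) : R :=
  match i, j with I1, I1 | I2, I2 => 1 | _, _ => 0 end.

Definition pd (i : idx) (f : R * R -> R) (p : R * R) : R :=
  match i with
  | I1 => Derive (fun s => f (s, snd p)) (fst p)
  | I2 => Derive (fun s => f (fst p, s)) (snd p)
  end.

Definition metric (i j : idx) (p : R * R) : R := delta i j / (snd p) ^ 2.

(* The inverse matrix of [metric], with upper indices. *)
Definition metric_inv (i j : idx) (p : R * R) : R := delta i j * (snd p) ^ 2.

Definition ginner (p u v : R * R) : R :=
  sum2 (fun i => sum2 (fun j => metric i j p * coord i u * coord j v)).

(* Christoffel symbols of the Levi-Civita connection, upper index [k]. *)
Definition christoffel (k i j : idx) (p : R * R) : R :=
  / 2 * sum2 (fun l => metric_inv k l p *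
                 (pd i (metric j l) p + pd j (metric i l) p - pd l (metric i j) p)).

Definition C1_curve (c : R -> R * R) : Prop :=
  forall t, 0 <= t <= 1 ->
    H2 (c t) /\
    forall i, ex_derive (fun s => coord i (c s)) t /\
              continuous (Derive (fun s => coord i (c s))) t.

Definition velocity (c : R -> R * R) (t : R) : R * R :=
  (Derive (fun s => fst (c s)) t, Derive (fun s => snd (c s)) t).

Definition curve_length (c : R -> R * R) : R :=
  RInt (fun t => sqrt (ginner (c t) (velocity c t) (velocity c t))) 0 1.

(* Riemannian distance.  Every C^1 curve on [0,1] extends to a C^1 function on R, so
   [C1_curve], which uses two-sided derivatives also at 0 and 1, loses no curve up to
   the values outside [0,1]. *)
Definition hdist (p q : R * R) : R :=
  real (Glb_Rbar (fun l => exists c : R -> R * R,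
          C1_curve c /\ c 0 = p /\ c 1 = q /\ l = curve_length c)).

(* Solutions of the geodesic equation.  The half-plane is complete, so every geodesic
   segment is the restriction to [0,1] of a geodesic defined on all of R. *)
Definition is_geodesic (c : R -> R * R) : Prop :=
  forall t, H2 (c t) /\
    forall k,
      ex_derive (fun s => coord k (c s)) t /\
      ex_derive (Derive (fun s => coord k (c s))) t /\
      Derive (Derive (fun s => coord k (c s))) t
        + sum2 (fun i => sum2 (fun j =>
            christoffel k i j (c t) * coord i (velocity c t) * coord j (velocity c t)))
      = 0.

Definition geod_segment (p q z : R * R) : Prop :=
  exists c : R -> R * R, is_geodesic c /\ c 0 = p /\ c 1 = q /\
    exists t, 0 <= t <= 1 /\ z = c t.

Definition gconvex (S : R * R -> Prop) : Prop :=
  (forall p, S p -> H2 p) /\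
  (forall p q z, S p -> S q -> geod_segment p q z -> S z).

Definition gconvex_hull (A : R * R -> Prop) (p : R * R) : Prop :=
  forall S : R * R -> Prop, gconvex S -> (forall q, A q -> S q) -> S p.

Definition geod_triangle (a b c : R * R) : R * R -> Prop :=
  gconvex_hull (fun q => q = a \/ q = b \/ q = c).

Definition set_interior (S : R * R -> Prop) (p : R * R) : Prop := locally p S.

(* Functions on an open set D are total functions on R * R whose values outside D are
   irrelevant. *)

Definition C3_on (D : R * R -> Prop) (F : R * R -> R) : Prop :=
  forall x y, D (x, y) -> ex_diff_n (fun s t => F (s, t)) 3 x y.

Definition grad (F : R * R -> R) (p : R * R) : R * R :=
  (sum2 (fun l => metric_inv I1 l p * pd l F p),
   sum2 (fun l => metric_inv I2 l p * pd l F p)).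

Definition hess_coef (F : R * R -> R) (i j : idx) (p : R * R) : R :=
  pd i (pd j F) p - sum2 (fun k => christoffel k i j p * pd k F p).

Definition hess (F : R * R -> R) (p u v : R * R) : R :=
  sum2 (fun i => sum2 (fun j => hess_coef F i j p * coord i u * coord j v)).

(* Component (i,j) of the covariant derivative of the Hessian in the direction of the
   k-th coordinate field. *)
Definition third_coef (F : R * R -> R) (k i j : idx) (p : R * R) : R :=
  pd k (hess_coef F i j) p
    - sum2 (fun l => christoffel l k i p * hess_coef F l j p)
    - sum2 (fun l => christoffel l k j p * hess_coef F i l p).

(* The differentiation direction is the first argument [u]. *)
Definition third_cov (F : R * R -> R) (p u v w : R * R) : R :=
  sum2 (fun k => sum2 (fun i => sum2 (fun j =>
    third_coef F k i j p * coord k u * coord i v * coord j w))).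

Definition epigraph (D : R * R -> Prop) (F : R * R -> R) (z : (R * R) * R) : Prop :=
  D (fst z) /\ F (fst z) <= snd z.

(* Closedness in the subspace H^2 x R of R^3. *)
Definition closed_in_H2xR (A : (R * R) * R -> Prop) : Prop :=
  exists C : (R * R) * R -> Prop,
    closed C /\ forall z, A z <-> H2 (fst z) /\ C z.

Definition strongly_1_self_concordant (D : R * R -> Prop) (F : R * R -> R) : Prop :=
  (forall p u v w, D p ->
     Rabs (third_cov F p u v w)
       <= 2 * sqrt (hess F p u u) * sqrt (hess F p v v) * sqrt (hess F p w w)) /\
  closed_in_H2xR (epigraph D F).

Definition is_barrier (theta : R) (D : R * R -> Prop) (F : R * R -> R) : Prop :=
  0 <= theta /\
  open D /\ gconvex D /\
  C3_on D F /\
  strongly_1_self_concordant D F /\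
  (forall p v, D p -> v <> (0, 0) -> 0 < hess F p v v) /\
  (forall p v, D p -> v <> (0, 0) ->
     ginner p (grad F p) v / sqrt (hess F p v v) <= sqrt theta).

(* Main.v *)
Require Import Defs.
From Stdlib Require Import Reals Lra Classical.
From Coquelicot Require Import Coquelicot.

(* Let O be the center of the triangle. The unit vectors from O to the vertices add up to zero, so
   the slope p of F along the geodesic from O to some vertex, parametrized by arc length t, is
   nonnegative at O and then increases. Let h = p' be the second derivative of F in the direction
   of this geodesic and k the one in the direction of its unit normal N, which is parallel.
   Self-concordance gives (ln k)' <= 2 sqrt h <= h + 1, hence ln k(s) - ln k(0) <= p(s) + s.
   On the other hand the triangle gets thin: with w the half-width at O in direction N, the
   transversal geodesic at time s leaves the triangle before time e^(-s) w. The closed epigraph and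
   self-concordance force sqrt k(s) >= e^s / w, whereas the barrier inequality at O yields
   sqrt k(0) <= (theta + 2 sqrt theta) / w. So p(s) >= s - 2 ln (theta + 2 sqrt theta).
   Finally p^2 <= theta p' prevents p from living longer than theta / p(s) after time s; as the
   circumradius is at least L/2, this gives (L/2 - s) p(s) <= theta, and s = L/4 is good enough. *)

Open Scope R_scope.

(** * Differentiation along geodesics *)

(** The half-plane carries the definitions, the hyperboloid carries the geometry: there geodesics
    are combinations of [cosh] and [sinh], the normal of a geodesic is a constant vector, and the
    triangle is a cone in which membership is read off the signs of three linear coordinates.
    Distance is an infimum over curves and the hull an intersection of convex sets, so each is
    estimated from both sides: Busemann functions bound lengths from below, half-planes bound the
    hull from outside. The gain is a mismatch of rates: thinning by e^(-s) forces ln k to grow by 2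
    s up to a constant, while 2 sqrt h <= h + 1 pays for only s of this besides the slope, which
    must supply the rest. The half-width w cancels between the bounds at O and at time s, so only
    theta is left in the constant. *)

Definition Cn_on (n : nat) (D : R * R -> Prop) (G : R * R -> R) : Prop :=
  forall p, D p -> ex_diff_n (fun s t => G (s, t)) n (fst p) (snd p).

Lemma Cn_on_pd n D G i : Cn_on (S n) D G -> Cn_on n D (pd i G).
Proof.
  intros H p Dp; destruct (H p Dp) as (_ & _ & _ & H1 & H2).
  destruct i; [exact H1 | exact H2].
Qed.

Lemma is_derive_comp_curve D G n (x y : R -> R) t x' y' :
  open D -> Cn_on (S n) D G -> D (x t, y t) ->
  is_derive x t x' -> is_derive y t y' ->
  is_derive (fun s => G (x s, y s)) t
    (pd I1 G (x t, y t) * x' + pd I2 G (x t, y t) * y').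
Proof.
  intros HD HG Dp Hx Hy.
  assert (Hdiff : differentiable_pt_lim (fun s t => G (s, t)) (x t) (y t)
            (pd I1 G (x t, y t)) (pd I2 G (x t, y t))).
  { apply filterdiff_differentiable_pt_lim.
    destruct (HG _ Dp) as (_ & _ & E2 & E3 & _).
    apply (is_derive_filterdiff (fun s t => G (s, t)) (x t) (y t)
            (fun u v => pd I1 G (u, v)) (pd I2 G (x t, y t))).
    - apply (filter_imp D); [|exact (HD _ Dp)].
      intros u Du; destruct (HG u Du) as (_ & E & _).
      exact (Derive_correct _ _ E).
    - exact (Derive_correct _ _ E2).
    - assert (C : continuity_2d_pt (fun u v => pd I1 G (u, v)) (x t) (y t)).
      { destruct n; apply E3. }
      apply continuity_2d_pt_filterlim in C.
      exact C. }
  apply is_derive_Reals.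
  apply (derivable_pt_lim_comp_2d (fun s t => G (s, t)) x y);
    [exact Hdiff | now apply is_derive_Reals | now apply is_derive_Reals].
Qed.

Lemma pd_metric k i j p : H2 p ->
  pd k (metric i j) p = match k with I1 => 0 | I2 => - 2 * delta i j / snd p ^ 3 end.
Proof.
  intros Hp; unfold H2 in Hp; destruct k; unfold pd, metric; simpl.
  - apply Derive_const.
  - apply is_derive_unique.
    auto_derive; [nra | field; lra].
Qed.

Definition christoffel_explicit (k i j : idx) (p : R * R) : R :=
  match k, i, j with
  | I1, I1, I2 | I1, I2, I1 | I2, I2, I2 => - / snd p
  | I2, I1, I1 => / snd p
  | _, _, _ => 0
  end.

Lemma christoffelE k i j p : H2 p -> christoffel k i j p = christoffel_explicit k i j p.
Proof.
  intros Hp; unfold christoffel, sum2.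
  rewrite !pd_metric by exact Hp.
  unfold H2 in Hp; unfold metric_inv, christoffel_explicit.
  destruct k, i, j; simpl; field; lra.
Qed.

Lemma open_H2 : open H2.
Proof.
  apply (open_comp (fun p : R * R => snd p) (fun y => 0 < y)).
  - intros p _; apply continuous_snd.
  - apply open_gt.
Qed.

Lemma geodesic_derive c t : is_geodesic c ->
  is_derive (fun s => fst (c s)) t (fst (velocity c t)) /\
  is_derive (fun s => snd (c s)) t (snd (velocity c t)).
Proof.
  intros G; destruct (G t) as [_ Hk]; split.
  - exact (Derive_correct _ _ (proj1 (Hk I1))).
  - exact (Derive_correct _ _ (proj1 (Hk I2))).
Qed.

(* The vanishing of the covariant derivative of [n] along [c], with the Christoffel symbols written out. *)
Definition parallel (c n : R -> R * R) : Prop :=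
  forall t,
    is_derive (fun s => fst (n s)) t
      ((fst (velocity c t) * snd (n t) + snd (velocity c t) * fst (n t)) / snd (c t)) /\
    is_derive (fun s => snd (n s)) t
      ((snd (velocity c t) * snd (n t) - fst (velocity c t) * fst (n t)) / snd (c t)).

Lemma parallel_velocity c : is_geodesic c -> parallel c (velocity c).
Proof.
  intros G t; destruct (G t) as [Hp Hk].
  pose proof (Hk I1) as (_ & E1 & F1); pose proof (Hk I2) as (_ & E2 & F2).
  unfold sum2 in F1, F2; rewrite !christoffelE in F1, F2 by exact Hp.
  unfold H2 in Hp; simpl in *.
  split.
  - evar_last; [exact (Derive_correct _ _ E1)|].
    simpl; apply Rminus_diag_uniq; rewrite <- F1; field; lra.
  - evar_last; [exact (Derive_correct _ _ E2)|].
    simpl; apply Rminus_diag_uniq; rewrite <- F2; field; lra.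
Qed.

Lemma is_derive_along D F n c t :
  open D -> Cn_on (S n) D F -> is_geodesic c -> D (c t) ->
  is_derive (fun s => F (c s)) t
    (pd I1 F (c t) * fst (velocity c t) + pd I2 F (c t) * snd (velocity c t)).
Proof.
  intros HD HF G Dt; destruct (geodesic_derive c t G) as [X Y].
  apply (is_derive_ext (fun s => F (fst (c s), snd (c s)))).
  { intros s; now rewrite <- surjective_pairing. }
  rewrite (surjective_pairing (c t)) at 1 2.
  apply (is_derive_comp_curve D F n (fun s => fst (c s)) (fun s => snd (c s)) t);
    try assumption.
  now rewrite <- surjective_pairing.
Qed.

Lemma ginner_grad F p v : H2 p ->
  ginner p (grad F p) v = pd I1 F p * fst v + pd I2 F p * snd v.
Proof.
  intros Hp; unfold H2 in Hp; unfold ginner, grad, metric, metric_inv, sum2; simpl.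
  field; lra.
Qed.

Lemma is_derive_grad D F c t :
  open D -> Cn_on 2 D F -> is_geodesic c -> D (c t) ->
  is_derive (fun s => ginner (c s) (grad F (c s)) (velocity c s)) t
    (hess F (c t) (velocity c t) (velocity c t)).
Proof.
  intros HD HF G Dt.
  apply (is_derive_ext (fun s => pd I1 F (c s) * fst (velocity c s)
                                 + pd I2 F (c s) * snd (velocity c s))).
  { intros s; symmetry; apply ginner_grad, G. }
  destruct (parallel_velocity c G t) as [P1 P2].
  pose proof (is_derive_along D (pd I1 F) 0 c t HD (Cn_on_pd 1 D F I1 HF) G Dt) as D1.
  pose proof (is_derive_along D (pd I2 F) 0 c t HD (Cn_on_pd 1 D F I2 HF) G Dt) as D2.
  evar_last.
  - apply @is_derive_plus; (apply @is_derive_mult; [eassumption | eassumption | apply Rmult_comm]).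
  - unfold plus, mult; simpl.
    pose proof (proj1 (G t)) as Hp.
    unfold hess, hess_coef, sum2; rewrite !christoffelE by exact Hp.
    unfold H2 in Hp; simpl; field; lra.
Qed.

(** A version of [hess_coef] that can be differentiated directly; the two agree only on [H2], so
    passing between them under a derivative needs that [H2] is open. *)
Definition hess_coef_explicit (F : R * R -> R) (i j : idx) (p : R * R) : R :=
  pd i (pd j F) p - sum2 (fun k => christoffel_explicit k i j p * pd k F p).

Lemma hess_coefE F i j p : H2 p -> hess_coef F i j p = hess_coef_explicit F i j p.
Proof.
  intros Hp; unfold hess_coef, hess_coef_explicit, sum2.
  now rewrite !christoffelE by exact Hp.
Qed.

Lemma pd_ext_loc i f g p : locally p (fun q => f q = g q) -> pd i f p = pd i g p.
Proof.
  intros [e He]; destruct p as [x y]; destruct i; unfold pd; simpl;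
    apply Derive_ext_loc; exists e; intros s Hs; apply He; split; simpl;
    solve [exact Hs | apply ball_center].
Qed.

Lemma ex_derive_pd n D G p : Cn_on (S n) D G -> D p ->
  ex_derive (fun s => G (s, snd p)) (fst p) /\
  ex_derive (fun s => G (fst p, s)) (snd p).
Proof. intros H Dp; destruct (H p Dp) as (_ & E1 & E2 & _); now split. Qed.

(** Each symbol is a constant multiple of 1/y, so its logarithmic derivative is - y'/y. *)
Lemma is_derive_christoffel k i j c t : is_geodesic c ->
  is_derive (fun s => christoffel_explicit k i j (c s)) t
    (- christoffel_explicit k i j (c t) * snd (velocity c t) / snd (c t)).
Proof.
  intros G; destruct (geodesic_derive c t G) as [_ Y].
  pose proof (proj1 (G t)) as Hp; unfold H2 in Hp.
  assert (E : is_derive (fun s => / snd (c s)) t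
                (- / snd (c t) * snd (velocity c t) / snd (c t))).
  { evar_last; [apply is_derive_inv; [exact Y | lra]|].
    simpl; field; lra. }
  assert (E' : is_derive (fun s => - / snd (c s)) t
                (- - / snd (c t) * snd (velocity c t) / snd (c t))).
  { evar_last; [apply @is_derive_opp; exact E|]. unfold opp; simpl; field; lra. }
  assert (E0 : is_derive (fun _ : R => 0) t (- 0 * snd (velocity c t) / snd (c t))).
  { evar_last; [apply @is_derive_const|]. unfold zero; simpl; field; lra. }
  destruct k, i, j; simpl; assumption.
Qed.

(** The extra sum for [I2] comes from differentiating the factor 1/y of the Christoffel symbols,
    which do not depend on x. *)
Lemma pd_hess_coef D F k i j p :
  open D -> Cn_on 3 D F -> D p -> H2 p ->
  pd k (hess_coef F i j) p =
    pd k (pd i (pd j F)) p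
    - sum2 (fun l => christoffel_explicit l i j p * pd k (pd l F) p)
    + match k with
      | I1 => 0
      | I2 => sum2 (fun l => christoffel_explicit l i j p / snd p * pd l F p)
      end.
Proof.
  intros HD HF Dp Hp.
  rewrite (pd_ext_loc k _ (hess_coef_explicit F i j)).
  2: { apply (filter_imp H2); [|exact (open_H2 p Hp)].
       intros q Hq; now apply hess_coefE. }
  assert (A1 : forall l, Cn_on 2 D (pd l F)) by (intros l; now apply Cn_on_pd).
  assert (A2 : Cn_on 1 D (pd i (pd j F))) by (apply Cn_on_pd, A1).
  destruct (ex_derive_pd _ _ _ _ (A1 I1) Dp) as [B1 B2].
  destruct (ex_derive_pd _ _ _ _ (A1 I2) Dp) as [B3 B4].
  destruct (ex_derive_pd _ _ _ _ A2 Dp) as [B5 B6].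
  unfold H2 in Hp; destruct k; unfold pd at 1, hess_coef_explicit, sum2;
    apply is_derive_unique.
  - assert (C : forall l, is_derive (fun s => christoffel_explicit l i j (s, snd p)) (fst p) 0).
    { intros l; destruct l, i, j; simpl; auto_derive; lra. }
    evar_last.
    + apply @is_derive_minus; [exact (Derive_correct _ _ B5)|].
      apply @is_derive_plus; (apply @is_derive_mult; [apply C | | apply Rmult_comm]);
        [exact (Derive_correct _ _ B1) | exact (Derive_correct _ _ B3)].
    + unfold minus, plus, opp, mult; simpl.
      destruct p as [x y]; unfold sum2, pd; simpl; ring.
  - assert (C : forall l, is_derive (fun s => christoffel_explicit l i j (fst p, s)) (snd p)
                  (- christoffel_explicit l i j p / snd p)).
    { intros l; destruct l, i, j; simpl; auto_derive; try lra; field; lra. }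
    evar_last.
    + apply @is_derive_minus; [exact (Derive_correct _ _ B6)|].
      apply @is_derive_plus; (apply @is_derive_mult; [apply C | | apply Rmult_comm]);
        [exact (Derive_correct _ _ B2) | exact (Derive_correct _ _ B4)].
    + unfold minus, plus, opp, mult; simpl.
      destruct p as [x y]; unfold sum2, pd, Rdiv; simpl; ring.
Qed.

(** Leibniz rule for the Hessian: the terms with the covariant derivative of [n] vanish because [n]
    is parallel. The direction of differentiation lands in the first slot of [third_cov]. *)
Lemma is_derive_hess_parallel D F c n t :
  open D -> Cn_on 3 D F -> is_geodesic c -> D (c t) -> parallel c n ->
  is_derive (fun s => hess F (c s) (n s) (n s)) t
    (third_cov F (c t) (velocity c t) (n t) (n t)).
Proof.
  intros HD HF G Dt Hn.
  apply (is_derive_ext (fun s => sum2 (fun i => sum2 (fun j =>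
    hess_coef_explicit F i j (c s) * coord i (n s) * coord j (n s))))).
  { intros s; unfold hess, sum2; now rewrite !hess_coefE by apply G. }
  assert (A1 : forall l, Cn_on 2 D (pd l F)) by (intros l; now apply Cn_on_pd).
  assert (A2 : forall i j, Cn_on 1 D (pd i (pd j F))) by (intros; now apply Cn_on_pd).
  pose proof (fun l => is_derive_along D (pd l F) 1 c t HD (A1 l) G Dt) as D1.
  pose proof (fun i j => is_derive_along D (pd i (pd j F)) 0 c t HD (A2 i j) G Dt) as D2.
  pose proof (fun k i j => is_derive_christoffel k i j c t G) as D3.
  destruct (Hn t) as [N1 N2].
  pose proof (proj1 (G t)) as Hp.
  assert (HC : forall i j, is_derive (fun s => hess_coef_explicit F i j (c s)) t
     (pd I1 (hess_coef F i j) (c t) * fst (velocity c t)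
      + pd I2 (hess_coef F i j) (c t) * snd (velocity c t))).
  { intros i j; rewrite !(pd_hess_coef D) by assumption.
    evar_last.
    - unfold hess_coef_explicit, sum2; apply @is_derive_minus; [apply D2|].
      apply @is_derive_plus; (apply @is_derive_mult; [apply D3 | apply D1 | apply Rmult_comm]).
    - unfold minus, plus, opp, mult, sum2; simpl.
      unfold H2 in Hp; field; lra. }
  evar_last.
  - unfold sum2; apply @is_derive_plus; apply @is_derive_plus;
     (apply @is_derive_mult; [apply @is_derive_mult; [apply HC | | apply Rmult_comm] | | apply Rmult_comm]);
     unfold coord; first [exact N1 | exact N2].
  - unfold third_cov, third_coef, sum2.
    rewrite !hess_coefE, !christoffelE by exact Hp.
    unfold H2 in Hp; unfold plus, mult, christoffel_explicit.
    cbn -[pd velocity hess_coef hess_coef_explicit]; field; lra.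
Qed.

(** * Self-concordance in one variable *)

Lemma derive_nonneg_le (f f' : R -> R) a b : a <= b ->
  (forall t, a <= t <= b -> is_derive f t (f' t)) ->
  (forall t, a <= t <= b -> 0 <= f' t) -> f a <= f b.
Proof.
  intros Hab Hd Hp.
  destruct (MVT_gen f a b f') as (c & Hc & E).
  - intros t Ht; rewrite Rmin_left, Rmax_right in Ht by lra; apply Hd; lra.
  - intros t Ht; rewrite Rmin_left, Rmax_right in Ht by lra.
    apply continuity_pt_filterlim, (ex_derive_continuous f); eexists; now apply Hd.
  - rewrite Rmin_left, Rmax_right in Hc by lra.
    pose proof (Hp c Hc); nra.
Qed.

Lemma derive_le_sub_le (f g f' g' : R -> R) a b : a <= b ->
  (forall t, a <= t <= b -> is_derive f t (f' t)) ->
  (forall t, a <= t <= b -> is_derive g t (g' t)) ->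
  (forall t, a <= t <= b -> f' t <= g' t) -> f b - f a <= g b - g a.
Proof.
  intros Hab Hf Hg Hle.
  enough (g a - f a <= g b - f b) by lra.
  apply (derive_nonneg_le (fun t => g t - f t) (fun t => g' t - f' t)); [exact Hab | |].
  - intros t Ht; apply @is_derive_minus; auto.
  - intros t Ht; specialize (Hle t Ht); lra.
Qed.

(** [p] and [h] play the first and second derivatives of a function along a geodesic. The interval
    is open at [T], where the geodesic may leave the domain. *)
Definition sc_path (T : R) (p h : R -> R) : Prop :=
  forall t, 0 <= t < T ->
    is_derive p t (h t) /\ 0 < h t /\
    exists h', is_derive h t h' /\ Rabs h' <= 2 * sqrt (h t) * sqrt (h t) * sqrt (h t).

Lemma is_derive_inv_sqrt h t h' : 0 < h t -> is_derive h t h' ->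
  is_derive (fun s => / sqrt (h s)) t (- h' / (2 * h t * sqrt (h t))).
Proof.
  intros Hp Hd.
  pose proof (sqrt_lt_R0 _ Hp) as Hs; pose proof (sqrt_sqrt (h t) (Rlt_le _ _ Hp)) as E.
  evar_last.
  - apply is_derive_inv; [|simpl; lra].
    apply (is_derive_comp sqrt h); [|exact Hd].
    apply is_derive_Reals, derivable_pt_lim_sqrt, Hp.
  - unfold scal; simpl; unfold mult; simpl.
    set (q := sqrt (h t)) in *; rewrite <- E; field; lra.
Qed.

(** The derivative of [1 / sqrt h] is - h' / (2 h^(3/2)), which self-concordance confines to
    [-1, 1]. *)
Lemma sc_path_inv_sqrt T p h t : sc_path T p h -> 0 <= t < T ->
  / sqrt (h 0) - t <= / sqrt (h t) <= / sqrt (h 0) + t.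
Proof.
  intros H Ht.
  assert (K : forall s, 0 <= s <= t -> exists l,
            is_derive (fun s => / sqrt (h s)) s l /\ -1 <= l <= 1).
  { intros s Hs; destruct (H s) as (_ & Hh & h' & Hd & Hb); [lra|].
    exists (- h' / (2 * h s * sqrt (h s))); split; [now apply is_derive_inv_sqrt|].
    pose proof (sqrt_lt_R0 _ Hh) as Hsq.
    pose proof (sqrt_sqrt (h s) (Rlt_le _ _ Hh)) as E.
    replace (2 * sqrt (h s) * sqrt (h s) * sqrt (h s)) with (2 * h s * sqrt (h s)) in Hb
      by (rewrite <- E at 1; ring).
    apply Rabs_le_between in Hb.
    assert (0 < 2 * h s * sqrt (h s)) by (apply Rmult_lt_0_compat; lra).
    split; [apply Rle_div_r | apply Rle_div_l]; lra. }
  set (f := fun s => / sqrt (h s)) in *.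
  (* The derivative is only known to exist pointwise; [Derive] turns it into a function to which the
     comparison lemma applies. *)
  assert (D : forall s, 0 <= s <= t -> is_derive f s (Derive f s) /\ -1 <= Derive f s <= 1).
  { intros s Hs; destruct (K s Hs) as (l & Hl & B).
    assert (Derive f s = l) as -> by (now apply is_derive_unique); now split. }
  assert (I : forall s, is_derive (fun s : R => s) s 1) by (intros s; apply @is_derive_id).
  split.
  - enough (- t <= f t - f 0) by (unfold f in *; lra).
    pose proof (derive_le_sub_le (fun s => - s) f (fun _ => -1) (Derive f) 0 t) as Q.
    cut (- t - - 0 <= f t - f 0); [lra|]; apply Q; try lra; intros s Hs.
    + apply @is_derive_opp, I.
    + now apply D.
    + now apply D.
  - enough (f t - f 0 <= t) by (unfold f in *; lra).
    pose proof (derive_le_sub_le f (fun s => s) (Derive f) (fun _ => 1) 0 t) as Q.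
    cut (f t - f 0 <= t - 0); [lra|]; apply Q; try lra; intros s Hs.
    + now apply D.
    + apply I.
    + now apply D.
Qed.

Lemma sc_path_incr T p h s t : sc_path T p h -> 0 <= s <= t -> t < T -> p s <= p t.
Proof.
  intros H Hst HT; apply (derive_nonneg_le p h); [lra | |]; intros u Hu;
    destruct (H u) as (H1 & H2 & _); try lra; assumption.
Qed.

(* [p / sqrt h <= sqrt theta] reads [(1/p)' <= - 1/theta], so [1/p] would reach [0] before
   time [T] were [p s] larger than [theta / (T - s)]. *)
Lemma sc_path_barrier T p h theta s : 0 <= theta -> sc_path T p h ->
  (forall t, 0 <= t < T -> p t <= sqrt theta * sqrt (h t)) ->
  0 <= s < T -> (T - s) * p s <= theta.
Proof.
  intros Hth H Hb Hs.
  destruct (Rle_lt_dec (p s) 0) as [|Hps]; [nra|].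
  assert (Hpos : forall u, s <= u < T -> 0 < p u).
  { intros u Hu; pose proof (sc_path_incr T p h s u H); lra. }
  assert (Hth' : forall u, s <= u < T -> p u ^ 2 <= theta * h u).
  { intros u Hu; destruct (H u) as (_ & Hh & _); [lra|].
    replace (theta * h u) with ((sqrt theta * sqrt (h u)) ^ 2).
    - apply pow_incr; split; [apply Rlt_le, Hpos; lra | apply Hb; lra].
    - rewrite Rpow_mult_distr, !pow2_sqrt; lra. }
  enough (K : forall t, s <= t < T -> (t - s) * p s <= theta).
  { apply Rnot_lt_le; intros Hlt.
    (* Halfway between the blow-up time s + theta / p(s) and [T]; there the claim [K] fails. *)
    set (t := s + theta / p s + ((T - s) - theta / p s) / 2).
    assert (0 <= theta / p s) by (apply Rmult_le_pos; [lra | apply Rlt_le, Rinv_0_lt_compat, Hps]).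
    assert (E : theta / p s * p s = theta) by (field; lra).
    assert (theta / p s < T - s) by nra.
    specialize (K t); unfold t in K; nra. }
  intros t Ht.
  assert (L : theta * / p t + t <= theta * / p s + s).
  { pose proof (derive_nonneg_le (fun u => - (theta * / p u + u))
      (fun u => - (theta * (- h u / p u ^ 2) + 1)) s t) as Q.
    enough (- (theta * / p s + s) <= - (theta * / p t + t)) by lra.
    apply Q; [lra | |]; intros u Hu; pose proof (Hpos u ltac:(lra)).
    - destruct (H u) as (Hd & _ & _); [lra|].
      apply @is_derive_opp, @is_derive_plus; [|apply @is_derive_id].
      apply is_derive_scal, is_derive_inv; [exact Hd | lra].
    - specialize (Hth' u ltac:(lra)).
      assert (0 < / p u ^ 2) by (apply Rinv_0_lt_compat; nra).
      assert (1 <= theta * h u * / p u ^ 2).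
      { rewrite <- (Rinv_r (p u ^ 2)) by nra; apply Rmult_le_compat_r; lra. }
      unfold Rdiv; lra. }
  pose proof (Hpos t ltac:(lra)) as Hpt.
  assert (0 <= theta * / p t) by (apply Rmult_le_pos; [lra | apply Rlt_le, Rinv_0_lt_compat, Hpt]).
  assert (E : theta * / p s * p s = theta) by (field; lra).
  nra.
Qed.

(** With r = sqrt (h 0), the Lipschitz bound on [1 / sqrt h] gives h(s) >= r^2 / (1 + s r)^2;
    integrating from 0 to t yields r - r / (1 + t r). *)
Lemma sc_path_growth T p h t : sc_path T p h -> 0 <= p 0 -> 0 <= t < T ->
  h 0 * t <= p t * (1 + t * sqrt (h 0)).
Proof.
  intros H Hp Ht.
  destruct (H 0) as (_ & H0 & _); [lra|].
  set (r := sqrt (h 0)); assert (Hr : 0 < r) by now apply sqrt_lt_R0.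
  assert (E : r * r = h 0) by (apply sqrt_sqrt; lra).
  assert (Q : (r - r / (1 + t * r)) - (r - r / (1 + 0 * r)) <= p t - p 0).
  { apply (derive_le_sub_le (fun s => r - r / (1 + s * r)) p
            (fun s => r * r / (1 + s * r) ^ 2) h); [lra | | |]; intros s Hs.
    - assert (0 < 1 + s * r) by nra.
      auto_derive; [lra | field; lra].
    - now apply H; lra.
    - destruct (H s) as (_ & Hh & _); [lra|].
      destruct (sc_path_inv_sqrt T p h s H ltac:(lra)) as [_ B].
      pose proof (sqrt_lt_R0 _ Hh) as Hsq; set (q := sqrt (h s)) in *.
      rewrite <- (sqrt_sqrt (h s)) by lra; fold q r in B |- *.
      assert (r <= q * (1 + s * r)).
      { assert (r * q * / q <= r * q * (/ r + s)) by (apply Rmult_le_compat_l; nra).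
        replace (r * q * / q) with r in * by (field; lra).
        replace (r * q * (/ r + s)) with (q * (1 + s * r)) in * by (field; lra); lra. }
      assert (0 < 1 + s * r) by nra.
      apply (Rmult_le_reg_r ((1 + s * r) ^ 2)); [nra|].
      unfold Rdiv; rewrite Rmult_assoc, Rinv_l; nra. }
  assert (0 < 1 + t * r) by nra.
  replace (r - r / (1 + t * r) - (r - r / (1 + 0 * r))) with (h 0 * t / (1 + t * r)) in Q
    by (rewrite <- E; field; lra).
  fold r; apply (Rmult_le_compat_r (1 + t * r)) in Q; [|lra].
  unfold Rdiv in Q; rewrite Rmult_assoc, Rinv_l in Q by lra; nra.
Qed.

(** Let q = sqrt (1 + T r) with r = sqrt (h 0). At the time t with 1 + t r = q, growth gives p(t) >=
    r (q - 1) / q and the barrier gives (T - t) p(t) <= theta; multiplied, these say (q - 1)^2 <=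
    theta. Hence T r = q^2 - 1 <= (1 + sqrt theta)^2 - 1. *)
Lemma sc_path_hessian_bound T p h theta : 0 < T -> 0 <= theta -> sc_path T p h ->
  (forall t, 0 <= t < T -> p t <= sqrt theta * sqrt (h t)) -> 0 <= p 0 ->
  T * sqrt (h 0) <= theta + 2 * sqrt theta.
Proof.
  intros HT Hth H Hb Hp.
  destruct (H 0) as (_ & H0 & _); [lra|].
  pose proof (sqrt_lt_R0 _ H0) as Hr; pose proof (sqrt_sqrt (h 0) (Rlt_le _ _ H0)) as E.
  set (r := sqrt (h 0)) in *; set (X := T * r).
  assert (HX : 0 < X) by now apply Rmult_lt_0_compat.
  set (q := sqrt (1 + X)).
  assert (Eq : q * q = 1 + X) by (apply sqrt_sqrt; lra).
  assert (Hq : 1 < q) by (unfold q; rewrite <- sqrt_1 at 1; apply sqrt_lt_1; lra).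
  (* The time at which the two bounds on [p] give the best constant. *)
  set (t := (q - 1) / r).
  assert (Et : t * r = q - 1) by (unfold t; field; lra).
  assert (Ht : 0 <= t < T).
  { split; [apply Rmult_le_pos; [lra | apply Rlt_le, Rinv_0_lt_compat, Hr]|].
    apply (Rmult_lt_reg_r r); [exact Hr|]. fold X; nra. }
  pose proof (sc_path_growth T p h t H Hp Ht) as G; fold r in G.
  pose proof (sc_path_barrier T p h theta t Hth H Hb Ht) as B.
  rewrite Et, <- E in G; replace (1 + (q - 1)) with q in G by ring.
  assert (G' : r * (q - 1) <= p t * q) by (rewrite <- Et; nra).
  assert (Hpt : 0 <= p t) by (apply Rnot_lt_le; intros K; nra).
  assert (Es : (T - t) * r = q * (q - 1)).
  { replace ((T - t) * r) with (X - t * r) by (unfold X; ring); rewrite Et; nra. }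
  assert (C : (q - 1) ^ 2 <= theta).
  { apply Rle_trans with ((T - t) * p t); [|exact B].
    apply (Rmult_le_reg_r (r * q)); [nra|].
    replace ((T - t) * p t * (r * q)) with (((T - t) * r) * (p t * q)) by ring.
    rewrite Es.
    apply Rle_trans with (q * (q - 1) * (r * (q - 1))); [right; ring|].
    apply Rmult_le_compat_l; nra. }
  pose proof (sqrt_pos theta); pose proof (sqrt_sqrt theta Hth).
  assert (q - 1 <= sqrt theta) by (apply Rnot_lt_le; intros K; nra).
  nra.
Qed.

(** [1 / sqrt h] stays above / sqrt (h 0) - T > 0, so [h] is bounded, and two integrations over a
    finite interval bound [p] and then [phi]. *)
Lemma sc_path_bounded T phi p h : 0 < T -> sc_path T p h ->
  (forall t, 0 <= t < T -> is_derive phi t (p t)) -> T * sqrt (h 0) < 1 ->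
  exists M, forall t, 0 <= t < T -> phi t <= M.
Proof.
  intros HT H Hphi HX.
  destruct (H 0) as (_ & H0 & _); [lra|].
  pose proof (sqrt_lt_R0 _ H0) as Hr.
  set (e := / sqrt (h 0) - T).
  assert (He : 0 < e).
  { unfold e; apply (Rmult_lt_reg_r (sqrt (h 0))); [exact Hr|].
    rewrite Rmult_minus_distr_r, Rinv_l; lra. }
  set (K := / e * / e).
  assert (HK : forall t, 0 <= t < T -> h t <= K).
  { intros t Ht; destruct (H t Ht) as (_ & Hh & _).
    destruct (sc_path_inv_sqrt T p h t H Ht) as [B _].
    pose proof (sqrt_lt_R0 _ Hh) as Hs.
    rewrite <- (sqrt_sqrt (h t)) by lra.
    assert (sqrt (h t) <= / e).
    { rewrite <- (Rinv_inv (sqrt (h t))); apply Rinv_le_contravar; unfold e in *; lra. }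
    apply Rmult_le_compat; lra. }
  assert (HK0 : 0 < K) by (apply Rmult_lt_0_compat; now apply Rinv_0_lt_compat).
  assert (Hp : forall t, 0 <= t < T -> p t <= Rabs (p 0) + K * T).
  { intros t Ht.
    assert (Q : p t - p 0 <= K * t - K * 0).
    { apply (derive_le_sub_le p (fun s => K * s) h (fun _ => K)); [lra | | |]; intros s Hs.
      - apply H; lra.
      - auto_derive; [easy | ring].
      - apply HK; lra. }
    pose proof (Rle_abs (p 0)); nra. }
  set (M := Rabs (p 0) + K * T) in *.
  assert (HM : 0 <= M) by (unfold M; pose proof (Rabs_pos (p 0)); nra).
  exists (phi 0 + M * T); intros t Ht.
  assert (Q : phi t - phi 0 <= M * t - M * 0).
  { apply (derive_le_sub_le phi (fun s => M * s) p (fun _ => M)); [lra | | |]; intros s Hs.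
    - apply Hphi; lra.
    - auto_derive; [easy | ring].
    - apply Hp; lra. }
  nra.
Qed.

(** * The hyperboloid model *)

(* The quadratic form [cu * cw - cv ^ 2] has signature (1,2); [mink] embeds the half-plane as
   one sheet of the hyperboloid on which it takes the value [1]. *)
Record vec := Vec { cu : R; cv : R; cw : R }.

Definition mink (p : R * R) : vec :=
  Vec (/ snd p) (fst p / snd p) ((fst p ^ 2 + snd p ^ 2) / snd p).

Definition proj (X : vec) : R * R := (cv X / cu X, / cu X).

(* The differential of [proj] at [mink p]. *)
Definition dproj (p : R * R) (V : vec) : R * R :=
  (snd p * (cv V - fst p * cu V), - cu V * snd p ^ 2).

(** The symmetric bilinear form of [cu * cw - cv ^ 2]; between two points of the hyperboloid it is
    the hyperbolic cosine of their distance ([hdist_polar]). *)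
Definition polar (X Y : vec) : R := (cu X * cw Y + cw X * cu Y) / 2 - cv X * cv Y.

Definition lin (a : R) (X : vec) (b : R) (Y : vec) : vec :=
  Vec (a * cu X + b * cu Y) (a * cv X + b * cv Y) (a * cw X + b * cw Y).

Definition ray (P V : vec) (t : R) : vec := lin (cosh t) P (sinh t) V.

(** A point with a unit tangent vector. Tangent vectors are negative for this signature, whence -1;
    the sign of [cu P] selects the sheet. *)
Definition frame (P V : vec) : Prop :=
  polar P P = 1 /\ polar P V = 0 /\ polar V V = -1 /\ 0 < cu P.

Lemma polar_lin_l a X b Y Z : polar (lin a X b Y) Z = a * polar X Z + b * polar Y Z.
Proof. unfold polar, lin; simpl; field. Qed.

Lemma polar_lin_r a X b Y Z : polar Z (lin a X b Y) = a * polar Z X + b * polar Z Y.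
Proof. unfold polar, lin; simpl; field. Qed.

Lemma polar_sym X Y : polar X Y = polar Y X.
Proof. unfold polar; simpl; field. Qed.

Lemma cosh_sqr t : cosh t * cosh t = 1 + sinh t * sinh t.
Proof. unfold cosh, sinh; rewrite !exp_Ropp; field. apply Rgt_not_eq, exp_pos. Qed.

Lemma cosh_pos t : 0 < cosh t.
Proof. unfold cosh; pose proof (exp_pos t); pose proof (exp_pos (- t)); lra. Qed.

Lemma mink_polar p : H2 p -> polar (mink p) (mink p) = 1.
Proof. intros H; unfold H2 in H; unfold polar, mink; simpl; field; lra. Qed.

Lemma mink_proj X : polar X X = 1 -> 0 < cu X -> mink (proj X) = X.
Proof.
  destruct X as [u v w]; unfold polar, mink, proj; simpl; intros E H.
  assert (w = (1 + v * v) / u) as -> by (field_simplify_eq; lra).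
  f_equal; field; lra.
Qed.

Lemma proj_mink p : H2 p -> proj (mink p) = p.
Proof.
  intros H; unfold H2 in H; destruct p as [x y]; simpl in H; unfold proj, mink; simpl.
  f_equal; field; lra.
Qed.

Lemma H2_proj X : 0 < cu X -> H2 (proj X).
Proof. intros H; unfold H2, proj; simpl; now apply Rinv_0_lt_compat. Qed.

Lemma frame_ray_polar P V t : frame P V -> polar (ray P V t) (ray P V t) = 1.
Proof.
  intros (E1 & E2 & E3 & _); unfold ray.
  rewrite polar_lin_l, !polar_lin_r, (polar_sym V P), E1, E2, E3.
  pose proof (cosh_sqr t); nra.
Qed.

(* [cu] is pairing with a null vector, which makes its gradient as long as [cu] itself. *)
Lemma frame_wedge P V : frame P V ->
  (cv V * cu P - cv P * cu V) ^ 2 = cu P ^ 2 - cu V ^ 2.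
Proof.
  destruct P as [a b c], V as [d e f]; intros (E1 & E2 & E3 & _); unfold polar in *; cbn [cu cv cw] in *.
  apply Rminus_diag_uniq.
  replace ((e * a - b * d) ^ 2 - (a ^ 2 - d ^ 2)) with
    (- a ^ 2 * ((d * f + f * d) / 2 - e * e + 1) + 2 * a * d * ((a * f + c * d) / 2 - b * e)
     - d ^ 2 * ((a * c + c * a) / 2 - b * b - 1)) by field.
  rewrite E1, E2, E3; ring.
Qed.

(** [frame_wedge] bounds |cu V| by cu P, so both exponentials have nonnegative coefficients, and
    these are not both zero. *)
Lemma frame_ray_pos P V t : frame P V -> 0 < cu (ray P V t).
Proof.
  intros HF; pose proof (frame_wedge P V HF) as W; destruct HF as (_ & _ & _ & H).
  set (k := cv V * cu P - cv P * cu V) in W.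
  unfold ray, lin; simpl.
  assert (A : - cu P <= cu V <= cu P) by nra.
  unfold cosh, sinh; pose proof (exp_pos t) as Ht; pose proof (exp_pos (- t)) as Ht'.
  enough (0 < exp t * (cu P + cu V) + exp (- t) * (cu P - cu V)) by lra.
  destruct (Rle_lt_dec 0 (cu V)); nra.
Qed.

(** [cosh] and [sinh] are each other's derivatives, so [ray V P] is the velocity of [ray P V]: the
    frame is transported along its own geodesic. *)
Lemma frame_ray P V t : frame P V -> frame (ray P V t) (ray V P t).
Proof.
  intros HF; repeat split.
  - now apply frame_ray_polar.
  - destruct HF as (E1 & E2 & E3 & _); unfold ray.
    rewrite polar_lin_l, !polar_lin_r, (polar_sym V P), E1, E2, E3; ring.
  - destruct HF as (E1 & E2 & E3 & _); unfold ray.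
    rewrite polar_lin_l, !polar_lin_r, (polar_sym V P), E1, E2, E3.
    pose proof (cosh_sqr t); nra.
  - now apply frame_ray_pos.
Qed.

Lemma ray_0 P V : ray P V 0 = P.
Proof. destruct P, V; unfold ray, lin; rewrite cosh_0, sinh_0; simpl; f_equal; ring. Qed.

Lemma is_derive_ray (co : vec -> R) P V d t :
  (forall a X b Y, co (lin a X b Y) = a * co X + b * co Y) ->
  is_derive (fun s => co (ray P V (d * s))) t (d * co (ray V P (d * t))).
Proof.
  intros Hco; unfold ray.
  apply (is_derive_ext (fun s => cosh (d * s) * co P + sinh (d * s) * co V)).
  { intros s; now rewrite Hco. }
  rewrite Hco; auto_derive; [easy | ring].
Qed.

(** The speed [d] fits a segment of length [d] to the parameter interval [0,1] of the definitions;
    [d = 1] is arc length. *)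
Definition geoline (P V : vec) (d t : R) : R * R := proj (ray P V (d * t)).

Lemma H2_geoline P V d t : frame P V -> H2 (geoline P V d t).
Proof. intros HF; apply H2_proj, frame_ray_pos, HF. Qed.

Lemma mink_geoline P V d t : frame P V -> mink (geoline P V d t) = ray P V (d * t).
Proof.
  intros HF; apply mink_proj; [now apply frame_ray_polar | now apply frame_ray_pos].
Qed.

Lemma geoline_derive P V d t : frame P V ->
  is_derive (fun s => fst (geoline P V d s)) t
    (d * (cv V * cu P - cv P * cu V) / cu (ray P V (d * t)) ^ 2) /\
  is_derive (fun s => snd (geoline P V d s)) t
    (- (d * cu (ray V P (d * t))) / cu (ray P V (d * t)) ^ 2).
Proof.
  intros HF; pose proof (frame_ray_pos P V (d * t) HF) as Hp.
  pose proof (is_derive_ray cu P V d t (fun _ _ _ _ => eq_refl)) as Du.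
  pose proof (is_derive_ray cv P V d t (fun _ _ _ _ => eq_refl)) as Dv.
  split; unfold geoline, proj; cbn [fst snd].
  - evar_last; [apply is_derive_div; [exact Dv | exact Du | now apply Rgt_not_eq]|].
    apply Rmult_eq_compat_r.
    unfold ray, lin; simpl; pose proof (cosh_sqr (d * t)) as C.
    replace (d * (cv V * cu P - cv P * cu V)) with
      (d * (cv V * cu P - cv P * cu V) * (cosh (d * t) * cosh (d * t) - sinh (d * t) * sinh (d * t)))
      by (rewrite C; ring).
    ring.
  - apply is_derive_inv; [exact Du | now apply Rgt_not_eq].
Qed.

Lemma velocity_geoline P V d t : frame P V ->
  velocity (geoline P V d) t =
    (d * (cv V * cu P - cv P * cu V) / cu (ray P V (d * t)) ^ 2,
     - (d * cu (ray V P (d * t))) / cu (ray P V (d * t)) ^ 2).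
Proof.
  intros HF; destruct (geoline_derive P V d t HF) as [D1 D2].
  unfold velocity; f_equal; now apply is_derive_unique.
Qed.

(** The Wronskian k of [cu] and [cv] is constant along the ray, so x' = d k y^2, which gives the
    first equation at once; the second reduces to [frame_wedge], moved along the ray. *)
Lemma geoline_geodesic P V d : frame P V -> is_geodesic (geoline P V d).
Proof.
  intros HF t.
  pose proof (frame_ray_pos P V (d * t) HF) as Hp.
  pose proof (fun s => geoline_derive P V d s HF) as D.
  pose proof (is_derive_ray cu P V d t (fun _ _ _ _ => eq_refl)) as Du.
  pose proof (is_derive_ray cu V P d t (fun _ _ _ _ => eq_refl)) as Du'.
  set (k := cv V * cu P - cv P * cu V) in *.
  assert (W : k ^ 2 = cu (ray P V (d * t)) ^ 2 - cu (ray V P (d * t)) ^ 2).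
  { unfold k; rewrite frame_wedge by exact HF.
    unfold ray, lin; simpl; pose proof (cosh_sqr (d * t)); nra. }
  set (c := geoline P V d) in *.
  assert (DD1 : is_derive (Derive (fun s => fst (c s))) t
    (- 2 * d * k * (d * cu (ray V P (d * t))) / cu (ray P V (d * t)) ^ 3)).
  { apply (is_derive_ext (fun s => (d * k) * / (cu (ray P V (d * s)) ^ 2))).
    { intros s; symmetry; apply is_derive_unique, D. }
    evar_last.
    - apply is_derive_scal, is_derive_inv; [apply is_derive_pow; exact Du | now apply pow_nonzero, Rgt_not_eq].
    - cbn -[ray cu]; field; lra. }
  assert (DD2 : is_derive (Derive (fun s => snd (c s))) t
    ((2 * (d * cu (ray V P (d * t))) ^ 2 / cu (ray P V (d * t)) ^ 3
       - d ^ 2 / cu (ray P V (d * t))))).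
  { apply (is_derive_ext (fun s => - (d * cu (ray V P (d * s))) / (cu (ray P V (d * s)) ^ 2))).
    { intros s; symmetry; apply is_derive_unique, D. }
    evar_last.
    - apply is_derive_div; [apply @is_derive_opp, is_derive_scal; exact Du'
        | apply is_derive_pow; exact Du | now apply pow_nonzero, Rgt_not_eq].
    - unfold opp; cbn -[ray cu]; field; lra. }
  split; [now apply H2_geoline|].
  assert (E : velocity c t = (d * k / cu (ray P V (d * t)) ^ 2,
     - (d * cu (ray V P (d * t))) / cu (ray P V (d * t)) ^ 2))
    by now apply velocity_geoline.
  assert (Ey : snd (c t) = / cu (ray P V (d * t))) by reflexivity.
  intros i; split; [|split].
  - destruct i; simpl; [exact (ex_intro _ _ (proj1 (D t))) | exact (ex_intro _ _ (proj2 (D t)))].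
  - destruct i; simpl; [exact (ex_intro _ _ DD1) | exact (ex_intro _ _ DD2)].
  - unfold sum2; rewrite !christoffelE by now apply H2_geoline.
    rewrite E; destruct i; unfold christoffel_explicit, coord.
    + rewrite (is_derive_unique _ _ _ DD1), Ey; cbn [fst snd]; field; lra.
    + rewrite (is_derive_unique _ _ _ DD2), Ey; cbn [fst snd].
      set (u := cu (ray P V (d * t))) in *; set (u' := cu (ray V P (d * t))) in *.
      apply (Rmult_eq_reg_r (u ^ 3)); [|now apply pow_nonzero, Rgt_not_eq].
      transitivity (d ^ 2 * (k ^ 2 - (u ^ 2 - u' ^ 2))); [field; lra | rewrite W; ring].
Qed.

Lemma velocity_dproj P V t : frame P V ->
  velocity (geoline P V 1) t = dproj (geoline P V 1 t) (ray V P (1 * t)).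
Proof.
  intros HF; rewrite velocity_geoline by exact HF.
  pose proof (frame_ray_pos P V (1 * t) HF) as Hp.
  unfold dproj, geoline, proj; cbn [fst snd].
  set (u := cu (ray P V (1 * t))) in *.
  f_equal; [|field; lra].
  replace (cv V * cu P - cv P * cu V) with
    (cv (ray V P (1 * t)) * u - cv (ray P V (1 * t)) * cu (ray V P (1 * t))).
  - field; lra.
  - unfold u, ray, lin; simpl; pose proof (cosh_sqr (1 * t)) as C.
    replace (cv V * cu P - cv P * cu V) with
      ((cv V * cu P - cv P * cu V) * (cosh (1 * t) * cosh (1 * t) - sinh (1 * t) * sinh (1 * t)))
      by (rewrite C; ring).
    ring.
Qed.

Lemma geoline_speed P V d t : frame P V ->
  ginner (geoline P V d t) (velocity (geoline P V d) t) (velocity (geoline P V d) t) = d ^ 2.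
Proof.
  intros HF; rewrite velocity_geoline by exact HF.
  pose proof (frame_ray_pos P V (d * t) HF) as Hp.
  assert (W : (cv V * cu P - cv P * cu V) ^ 2
              = cu (ray P V (d * t)) ^ 2 - cu (ray V P (d * t)) ^ 2).
  { rewrite frame_wedge by exact HF.
    unfold ray, lin; simpl; pose proof (cosh_sqr (d * t)); nra. }
  unfold ginner, metric, sum2, geoline, proj; cbn [coord fst snd delta].
  set (k := cv V * cu P - cv P * cu V) in *.
  set (u := cu (ray P V (d * t))) in *; set (u' := cu (ray V P (d * t))) in *.
  apply (Rmult_eq_reg_r (u ^ 2)); [|now apply pow_nonzero, Rgt_not_eq].
  transitivity (d ^ 2 * (k ^ 2 + u' ^ 2)); [field; lra | rewrite W; ring].
Qed.

Lemma mink_orth p W : H2 p -> polar (mink p) W = 0 ->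
  cw W = 2 * fst p * cv W - (fst p ^ 2 + snd p ^ 2) * cu W.
Proof.
  intros Hp E; unfold H2 in Hp; unfold polar, mink in E; cbn [cu cv cw] in E.
  apply (Rmult_eq_compat_r (2 * snd p)) in E; field_simplify in E; lra.
Qed.

(** Tangency determines [cw]; once it is eliminated from W and N, their orthogonality is this
    relation, up to a factor - y. *)
Lemma dproj_orth p W N : H2 p ->
  polar (mink p) W = 0 -> polar (mink p) N = 0 -> polar W N = 0 ->
  fst (dproj p W) * cv N =
    cu N * (fst p * fst (dproj p W) + snd p * snd (dproj p W)).
Proof.
  intros Hp EW EN E; apply (mink_orth p) in EW, EN; try exact Hp.
  unfold polar in E; rewrite EW, EN in E; unfold dproj; cbn [fst snd].
  apply Rminus_diag_uniq.
  match type of E with ?e = 0 => transitivity (- snd p * e); [field | rewrite E; ring] end.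
Qed.

(** [N] is orthogonal to the plane spanned by [P] and [V], which contains the geodesic and its
    velocity. It is therefore a normal tangent vector at every point, and being constant in the
    ambient space it has zero covariant derivative. *)
Lemma parallel_normal P V N : frame P V -> polar P N = 0 -> polar V N = 0 ->
  parallel (geoline P V 1) (fun t => dproj (geoline P V 1 t) N).
Proof.
  intros HF HP HV t.
  pose proof (geoline_geodesic P V 1 HF) as G.
  destruct (geodesic_derive _ t G) as [D1 D2].
  pose proof (proj1 (G t)) as Hp; unfold H2 in Hp.
  pose proof (mink_geoline P V 1 t HF) as M.
  assert (Ev := velocity_dproj P V t HF).
  assert (R1 : polar (mink (geoline P V 1 t)) N = 0)
    by (rewrite M; unfold ray; rewrite polar_lin_l, HP, HV; ring).
  assert (R2 : polar (ray V P (1 * t)) N = 0)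
    by (unfold ray; rewrite polar_lin_l, HP, HV; ring).
  assert (R3 : fst (velocity (geoline P V 1) t) * cv N =
     cu N * (fst (geoline P V 1 t) * fst (velocity (geoline P V 1) t)
             + snd (geoline P V 1 t) * snd (velocity (geoline P V 1) t))).
  { rewrite Ev; apply dproj_orth; try assumption.
    rewrite M; destruct (frame_ray P V (1 * t) HF) as (_ & E & _); exact E. }
  clear Ev M R1; set (c := geoline P V 1) in *; clearbody c.
  unfold dproj; cbn [fst snd]; split.
  - evar_last.
    + apply @is_derive_mult; [exact D2 | | apply Rmult_comm].
      apply @is_derive_minus; [apply @is_derive_const|].
      apply @is_derive_mult; [exact D1 | apply @is_derive_const | apply Rmult_comm].
    + unfold plus, mult, minus, opp, zero; cbn -[velocity].
      unfold plus, opp, zero; cbn -[velocity]; field; lra.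
  - evar_last.
    + apply is_derive_scal, is_derive_pow; exact D2.
    + cbn -[velocity].
      set (x' := fst (velocity c t)) in *; set (y' := snd (velocity c t)) in *.
      field_simplify_eq; [|lra].
      apply Rminus_diag_uniq; apply Rminus_diag_eq in R3.
      match goal with |- ?g = 0 => match type of R3 with ?e = 0 =>
        transitivity (snd (c t) * e); [ring | rewrite R3; ring] end end.
Qed.

(** * The Riemannian distance *)

Lemma polar_minkE p N : H2 p ->
  polar (mink p) N
    = (cu N * (fst p ^ 2 + snd p ^ 2) + cw N - 2 * cv N * fst p) / (2 * snd p).
Proof. intros Hp; unfold H2 in Hp; unfold polar, mink; cbn [cu cv cw]; field; lra. Qed.

(** For N = (u, v, w) null, u times the numerator of [polar_minkE] is (u x - v)^2 + (u y)^2, so the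
    sign is that of u everywhere; if u = 0 then v = 0 and the numerator is the constant w. *)
Lemma null_pos p q N : H2 p -> H2 q -> polar N N = 0 ->
  0 < polar (mink p) N -> 0 < polar (mink q) N.
Proof.
  intros Hp Hq EN; rewrite !polar_minkE by assumption.
  destruct N as [u v w]; unfold H2 in *; unfold polar in EN; cbn [cu cv cw] in *.
  set (g := fun p => u * (fst p ^ 2 + snd p ^ 2) + w - 2 * v * fst p).
  change (0 < g p / (2 * snd p) -> 0 < g q / (2 * snd q)).
  intros Gp.
  assert (Gp' : 0 < g p).
  { replace (g p) with (g p / (2 * snd p) * (2 * snd p)) by (field; lra).
    apply Rmult_lt_0_compat; lra. }
  assert (Gu : forall r, u * g r = (u * fst r - v) ^ 2 + (u * snd r) ^ 2) by (intros r; unfold g; lra).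
  apply Rdiv_lt_0_compat; [|lra].
  destruct (Rtotal_order u 0) as [Hu | [Hu | Hu]].
  - specialize (Gu p); pose proof (pow2_ge_0 (u * fst p - v)); pose proof (pow2_ge_0 (u * snd p)).
    assert (u * g p < 0) by nra; lra.
  - assert (v = 0) by nra; unfold g in *; subst; lra.
  - specialize (Gu q); pose proof (pow2_ge_0 (u * fst q - v)).
    assert (0 < (u * snd q) ^ 2) by (apply pow_lt, Rmult_lt_0_compat; lra).
    apply (Rmult_lt_reg_l u); lra.
Qed.

Definition polar_deriv (N : vec) (c : R -> R * R) (t : R) : R :=
  ((cu N * fst (c t) - cv N) * fst (velocity c t)
     + cu N * snd (c t) * snd (velocity c t)) / snd (c t)
  - polar (mink (c t)) N * snd (velocity c t) / snd (c t).

Lemma is_derive_polar N c t : H2 (c t) ->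
  (forall i, ex_derive (fun s => coord i (c s)) t) ->
  is_derive (fun s => polar (mink (c s)) N) t (polar_deriv N c t).
Proof.
  intros Hp Hd; unfold H2 in Hp.
  pose proof (Hd I1) as D1; pose proof (Hd I2) as D2; cbn [coord] in D1, D2.
  unfold polar_deriv; rewrite polar_minkE by exact Hp.
  unfold polar, mink, velocity; cbn [cu cv cw fst snd].
  set (x := fun s => fst (c s)) in *; set (y := fun s => snd (c s)) in *.
  change (fst (c t)) with (x t) in *; change (snd (c t)) with (y t) in *.
  change (Derive (fun s => fst (c s)) t) with (Derive x t).
  change (Derive (fun s => snd (c s)) t) with (Derive y t).
  apply (is_derive_ext (fun s => (/ y s * cw N + (x s ^ 2 + y s ^ 2) / y s * cu N) / 2
                                 - x s / y s * cv N)); [reflexivity|].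
  clearbody x y.
  auto_derive; [repeat split; try assumption; lra|].
  change (fun s => x s) with x; change (fun s => y s) with y; field; lra.
Qed.

Lemma ginnerE p v : H2 p -> ginner p v v = (fst v ^ 2 + snd v ^ 2) / snd p ^ 2.
Proof.
  intros Hp; unfold H2 in Hp; unfold ginner, metric, sum2; simpl; field; lra.
Qed.

(* [polar _ N] with [N] null is the exponential of a Busemann function, whose gradient has
   norm [1]. *)
Lemma polar_deriv_le N c t : H2 (c t) -> polar N N = 0 -> 0 < polar (mink (c t)) N ->
  - polar_deriv N c t / polar (mink (c t)) N
    <= sqrt (ginner (c t) (velocity c t) (velocity c t)).
Proof.
  intros Hp EN Hf; pose proof Hp as Hp'; unfold H2 in Hp'.
  rewrite ginnerE by exact Hp; unfold polar_deriv.
  set (f := polar (mink (c t)) N) in *.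
  destruct (velocity c t) as [x' y']; cbn [fst snd].
  assert (Ef : 2 * snd (c t) * f = cu N * (fst (c t) ^ 2 + snd (c t) ^ 2) + cw N - 2 * cv N * fst (c t)).
  { unfold f; rewrite polar_minkE by exact Hp; field; lra. }
  destruct (c t) as [x y]; cbn [fst snd] in *.
  apply Rsqr_incr_0_var; [|apply sqrt_pos].
  unfold Rsqr; rewrite sqrt_sqrt.
  2: { apply Rmult_le_pos; [nra | apply Rlt_le, Rinv_0_lt_compat; nra]. }
  destruct N as [u v w]; unfold polar in EN; cbn [cu cv cw] in *.
  set (A := u * x - v).
  (* A / f and (u y - f) / f are the components of the gradient of ln f in the orthonormal frame, so
     this is its unit length; Cauchy-Schwarz finishes. *)
  assert (EA : A ^ 2 + (u * y - f) ^ 2 = f ^ 2).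
  { assert (A ^ 2 + (u * y) ^ 2 = u * (2 * y * f)) by (rewrite Ef; unfold A; lra); nra. }
  replace (- ((A * x' + u * y * y') / y - f * y' / y) / f)
    with (- (A * x' + (u * y - f) * y') / (y * f)) by (field; lra).
  set (B := u * y - f) in *.
  replace (- (A * x' + B * y') / (y * f) * (- (A * x' + B * y') / (y * f)))
    with ((A * x' + B * y') ^ 2 / (y ^ 2 * f ^ 2)) by (field; lra).
  apply Rle_div_l; [apply Rmult_lt_0_compat; nra|].
  replace ((x' ^ 2 + y' ^ 2) / y ^ 2 * (y ^ 2 * f ^ 2)) with ((x' ^ 2 + y' ^ 2) * f ^ 2)
    by (field; lra).
  rewrite <- EA.
  pose proof (pow2_ge_0 (A * y' - B * x')); nra.
Qed.

Ltac continuity_tac :=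
  repeat first
    [ assumption
    | apply @continuous_const
    | apply @continuous_plus
    | apply @continuous_minus
    | apply (@continuous_opp _ R_AbsRing)
    | apply (@continuous_mult _ R_AbsRing)
    | apply continuous_Rinv_comp
    | apply continuous_sqrt_comp ].

Lemma C1_continuous c t : C1_curve c -> 0 <= t <= 1 ->
  continuous (fun s => fst (c s)) t /\ continuous (fun s => snd (c s)) t /\
  continuous (fun s => fst (velocity c s)) t /\ continuous (fun s => snd (velocity c s)) t.
Proof.
  intros H Ht; destruct (H t Ht) as [_ K].
  destruct (K I1) as [A1 A2], (K I2) as [B1 B2].
  repeat split; try assumption; now apply (ex_derive_continuous (V := R_NormedModule)).
Qed.

Lemma speed_continuous c t : C1_curve c -> 0 <= t <= 1 ->
  continuous (fun s => sqrt (ginner (c s) (velocity c s) (velocity c s))) t.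
Proof.
  intros H Ht; destruct (C1_continuous c t H Ht) as (C1 & C2 & C3 & C4).
  destruct (H t Ht) as [Hp _]; unfold H2 in Hp.
  unfold ginner, sum2, metric, Rdiv; cbn [coord].
  continuity_tac; apply Rgt_not_eq; simpl; nra.
Qed.

Lemma speed_ex_RInt c : C1_curve c ->
  ex_RInt (fun s => sqrt (ginner (c s) (velocity c s) (velocity c s))) 0 1.
Proof.
  intros H; apply (ex_RInt_continuous (V := R_CompleteNormedModule)); intros t Ht.
  rewrite Rmin_left, Rmax_right in Ht by lra; now apply speed_continuous.
Qed.

(** Integrating [polar_deriv_le]: a Busemann function cannot drop faster than length accrues, which
    bounds all competing curves at once. *)
Lemma curve_length_null c N : C1_curve c -> polar N N = 0 -> 0 < polar (mink (c 0)) N ->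
  ln (polar (mink (c 0)) N) - ln (polar (mink (c 1)) N) <= curve_length c.
Proof.
  intros H EN Hp.
  assert (Hf : forall t, 0 <= t <= 1 -> 0 < polar (mink (c t)) N).
  { intros t Ht; apply (null_pos (c 0)); try assumption; apply H; lra. }
  assert (I : is_RInt (fun t => - polar_deriv N c t / polar (mink (c t)) N) 0 1
    (minus (- ln (polar (mink (c 1)) N)) (- ln (polar (mink (c 0)) N)))).
  { apply (is_RInt_derive (V := R_CompleteNormedModule) (fun t => - ln (polar (mink (c t)) N)));
      intros t Ht; rewrite Rmin_left, Rmax_right in Ht by lra; specialize (Hf t Ht);
      destruct (H t Ht) as [Ht1 Ht2].
    - evar_last.
      + apply @is_derive_opp, (is_derive_comp ln); [apply is_derive_Reals, derivable_pt_lim_ln, Hf|].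
        apply is_derive_polar; [exact Ht1 | intros i; apply Ht2].
      + unfold opp, scal; simpl; unfold mult; simpl; field; lra.
    - destruct (C1_continuous c t H Ht) as (C1 & C2 & C3 & C4); unfold H2 in Ht1.
      assert (C : continuous (fun s => polar (mink (c s)) N) t).
      { apply (ex_derive_continuous (V := R_NormedModule)); eexists.
        apply is_derive_polar; [exact Ht1 | intros i; apply Ht2]. }
      unfold polar_deriv, Rdiv; continuity_tac; lra. }
  replace (ln (polar (mink (c 0)) N) - ln (polar (mink (c 1)) N)) with
    (RInt (fun t => - polar_deriv N c t / polar (mink (c t)) N) 0 1).
  - apply RInt_le; [lra | eexists; exact I | now apply speed_ex_RInt |].
    intros t Ht; apply polar_deriv_le; [apply H; lra | exact EN | apply Hf; lra].
  - rewrite (is_RInt_unique _ _ _ _ I); unfold minus, plus, opp; simpl; ring.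
Qed.

Lemma sinh_pos t : 0 < t -> 0 < sinh t.
Proof. intros H; rewrite <- sinh_0; now apply sinh_lt. Qed.

Lemma sinh_nonneg t : 0 <= t -> 0 <= sinh t.
Proof. intros [H | <-]; [apply Rlt_le; now apply sinh_pos | rewrite sinh_0; lra]. Qed.

Lemma exp_opp_cosh t : exp (- t) = cosh t - sinh t.
Proof. unfold cosh, sinh; field. Qed.

Lemma polar_mink_le p q : H2 p -> H2 q -> 1 <= polar (mink p) (mink q) /\
  (polar (mink p) (mink q) = 1 -> p = q).
Proof.
  intros Hp Hq.
  assert (E : polar (mink p) (mink q)
    = 1 + ((fst p - fst q) ^ 2 + (snd p - snd q) ^ 2) / (2 * snd p * snd q)).
  { unfold H2 in *; unfold polar, mink; cbn [cu cv cw]; field; lra. }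
  unfold H2 in *; assert (Hpq : 0 < 2 * snd p * snd q) by (apply Rmult_lt_0_compat; lra).
  rewrite E; set (r := (fst p - fst q) ^ 2 + (snd p - snd q) ^ 2).
  assert (Hr : 0 <= r) 
    by (unfold r; apply Rplus_le_le_0_compat; apply pow2_ge_0).
  split.
  - assert (0 <= r / (2 * snd p * snd q)); [|lra].
    apply Rmult_le_pos; [exact Hr | apply Rlt_le, Rinv_0_lt_compat, Hpq].
  - intros E1.
    assert (r = 0).
    { replace r with (r / (2 * snd p * snd q) * (2 * snd p * snd q)) by (field; lra).
      replace (r / (2 * snd p * snd q)) with 0 by lra; ring. }
    destruct (Rplus_sqr_eq_0 (fst p - fst q) (snd p - snd q)) as [E2 E3].
    { unfold Rsqr, r in *; lra. }
    destruct p, q; cbn [fst snd] in *; f_equal; lra.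
Qed.

Lemma cosh_arcsinh x : cosh (arcsinh x) = sqrt (1 + x ^ 2).
Proof.
  pose proof (cosh_sqr (arcsinh x)) as E; rewrite sinh_arcsinh in E.
  symmetry; apply sqrt_lem_1; [nra | apply Rlt_le, cosh_pos | rewrite E; ring].
Qed.

Lemma arcosh_exists b : 1 <= b -> exists d, 0 <= d /\ cosh d = b.
Proof.
  intros Hb; exists (arcsinh (sqrt (b ^ 2 - 1))); split.
  - rewrite <- arcsinh_0; apply arcsinh_le, sqrt_pos.
  - rewrite cosh_arcsinh, pow2_sqrt by nra.
    replace (1 + (b ^ 2 - 1)) with (b ^ 2) by ring; apply sqrt_pow2; lra.
Qed.

(** The unit tangent at [P] towards [Q], obtained by solving Q = cosh d P + sinh d V for V. *)
Definition frame_dir (P Q : vec) (d : R) : vec := lin (/ sinh d) Q (- (cosh d / sinh d)) P.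

Lemma frame_dir_frame P Q d : 0 < d -> polar P P = 1 -> polar Q Q = 1 ->
  polar P Q = cosh d -> 0 < cu P -> frame P (frame_dir P Q d).
Proof.
  intros Hd EP EQ E Hp; pose proof (sinh_pos d Hd) as Hs; pose proof (cosh_sqr d) as C.
  repeat split; unfold frame_dir; try assumption.
  - rewrite polar_lin_r, E, EP; field; lra.
  - rewrite polar_lin_l, !polar_lin_r, (polar_sym Q P), E, EP, EQ.
    apply (Rmult_eq_reg_r (sinh d * sinh d)); [|nra].
    field_simplify; [|lra]; nra.
Qed.

Lemma frame_dir_ray P Q d : 0 < d -> ray P (frame_dir P Q d) d = Q.
Proof.
  intros Hd; pose proof (sinh_pos d Hd).
  destruct P, Q; unfold ray, frame_dir, lin; simpl; f_equal; field; lra.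
Qed.

Lemma cu_mink_pos p : H2 p -> 0 < cu (mink p).
Proof. intros H; now apply Rinv_0_lt_compat. Qed.

Lemma geoline_C1 P V d : frame P V -> C1_curve (geoline P V d).
Proof.
  intros HF t _; pose proof (geoline_geodesic P V d HF t) as [H1 H2].
  split; [exact H1 | intros i; destruct (H2 i) as (A & B & _); split; [exact A|]].
  now apply (ex_derive_continuous (V := R_NormedModule)).
Qed.

Lemma geoline_length P V d : 0 <= d -> frame P V -> curve_length (geoline P V d) = d.
Proof.
  intros Hd HF; unfold curve_length.
  rewrite (RInt_ext _ (fun _ => d)).
  - rewrite RInt_const; unfold scal; simpl; unfold mult; simpl; ring.
  - intros t _; rewrite geoline_speed by exact HF; now apply sqrt_pow2.
Qed.

(** The number d with cosh d = [polar (mink p) (mink q)] is a lower bound for lengths by a suitable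
    Busemann function, and the explicit geodesic attains it. *)
Lemma hdist_polar p q : H2 p -> H2 q ->
  0 <= hdist p q /\ cosh (hdist p q) = polar (mink p) (mink q).
Proof.
  intros Hp Hq; pose proof (polar_mink_le p q Hp Hq) as [Hb Hb1].
  destruct (arcosh_exists _ Hb) as (d & Hd & Ed).
  enough (hdist p q = d) as -> by (split; [exact Hd | exact Ed]).
  unfold hdist.
  enough (G : is_glb_Rbar (fun l => exists c, C1_curve c /\ c 0 = p /\ c 1 = q /\ l = curve_length c) d)
    by now rewrite (is_glb_Rbar_unique _ _ G).
  split.
  - intros l (c & Hc & E0 & E1 & ->); cbn [Rbar_le].
    destruct (Rle_lt_dec d 0) as [Hd0 | Hd0].
    { apply Rle_trans with 0; [exact Hd0|].
      apply RInt_ge_0; [lra | now apply speed_ex_RInt | intros t _; apply sqrt_pos]. }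
    (* The null vector in the plane of the two points, a multiple of P + V for the direction V from
       p to q. It represents the ideal endpoint of the geodesic beyond q, so the logarithm drops by
       exactly d. *)
    set (N := lin 1 (mink q) (- exp (- d)) (mink p)).
    assert (Ee : exp (- d) = cosh d - sinh d) by apply exp_opp_cosh.
    pose proof (cosh_sqr d) as C; pose proof (sinh_pos d Hd0) as Hs.
    assert (NP : polar (mink p) N = sinh d).
    { unfold N; rewrite polar_lin_r, <- Ed, mink_polar by exact Hp; lra. }
    assert (NQ : polar (mink q) N = exp (- d) * sinh d).
    { unfold N; rewrite polar_lin_r, (polar_sym (mink q) (mink p)), <- Ed, mink_polar by exact Hq.
      rewrite Ee; nra. }
    assert (NN : polar N N = 0).
    { unfold N at 1; rewrite polar_lin_l, NP, NQ; ring. }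
    replace d with (ln (polar (mink (c 0)) N) - ln (polar (mink (c 1)) N)).
    + apply curve_length_null; [exact Hc | exact NN | rewrite E0, NP; exact Hs].
    + rewrite E0, E1, NP, NQ, ln_mult, ln_exp by (try apply exp_pos; lra); ring.
  - intros b Hlb; apply Hlb; destruct (Rle_lt_dec d 0) as [Hd0 | Hd0].
    (* [frame_dir] divides by sinh d, so coincident points are joined by the constant curve
       instead. *)
    + assert (d = 0) by lra; subst d; rewrite cosh_0 in Ed; specialize (Hb1 (eq_sym Ed)); subst q.
      assert (V : forall t, velocity (fun _ => p) t = (0, 0)).
      { intros t; unfold velocity; now rewrite !Derive_const. }
      exists (fun _ => p); split; [|split; [|split]]; trivial.
      * intros t _; split; [exact Hp|]; intros i; split; [apply ex_derive_const|].
        apply (continuous_ext (fun _ => 0)); [|apply continuous_const].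
        intros s; symmetry; apply Derive_const.
      * unfold curve_length; rewrite (RInt_ext _ (fun _ => 0)).
        { rewrite RInt_const; unfold scal; simpl; unfold mult; simpl; ring. }
        intros t _; rewrite V, ginnerE by exact Hp; cbn [fst snd].
        transitivity (sqrt 0); [f_equal; unfold Rdiv; ring | apply sqrt_0].
    + assert (HF : frame (mink p) (frame_dir (mink p) (mink q) d)).
      { apply frame_dir_frame; [exact Hd0 | now apply mink_polar | now apply mink_polar | now symmetry
          | now apply cu_mink_pos]. }
      exists (geoline (mink p) (frame_dir (mink p) (mink q) d) d); split; [|split; [|split]].
      * now apply geoline_C1.
      * unfold geoline; rewrite Rmult_0_r, ray_0; now apply proj_mink.
      * unfold geoline; rewrite Rmult_1_r, frame_dir_ray by exact Hd0; now apply proj_mink.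
      * symmetry; now apply geoline_length.
Qed.

(** * Convex hulls *)

(* Along a geodesic, [polar (mink _) N] and [/ y = cu (mink _)] solve the same second-order linear
   equation, so their Wronskian is constant: the quotient has derivative [K y^2]. *)
Lemma polar_quotient_derive c N : is_geodesic c ->
  exists K, forall t, 0 <= t <= 1 ->
    is_derive (fun s => polar (mink (c s)) N * snd (c s)) t (K * snd (c t) ^ 2).
Proof.
  intros G.
  set (W := fun t => (cu N * (fst (c t) * fst (velocity c t) + snd (c t) * snd (velocity c t))
                      - cv N * fst (velocity c t)) / snd (c t) ^ 2).
  assert (DW : forall t, is_derive W t 0).
  { intros t; destruct (geodesic_derive c t G) as [D1 D2].
    destruct (parallel_velocity c G t) as [D3 D4].
    pose proof (proj1 (G t)) as Hp; unfold H2 in Hp.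
    evar_last.
    - apply is_derive_div; [| apply is_derive_pow; exact D2 | now apply pow_nonzero, Rgt_not_eq].
      apply @is_derive_minus; apply is_derive_scal; [|exact D3].
      apply @is_derive_plus; (apply @is_derive_mult; [eassumption | eassumption | apply Rmult_comm]).
    - unfold minus, plus, opp, mult; cbn -[velocity].
      unfold plus, mult, opp; cbn -[velocity]; field; lra. }
  exists (W 0); intros t Ht.
  assert (EW : W t = W 0).
  { enough (W t - W 0 <= 0 - 0 /\ - W t - - W 0 <= 0 - 0) by lra; split.
          - apply (derive_le_sub_le W (fun _ => 0) (fun _ => 0) (fun _ => 0)); try lra; intros;
        first [lra | apply DW | apply @is_derive_const].
    - apply (derive_le_sub_le (fun s => - W s) (fun _ => 0) (fun _ => - 0) (fun _ => 0)); try lra; intros;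
        first [lra | apply @is_derive_opp, DW | apply @is_derive_const]. }
  rewrite <- EW.
  destruct (geodesic_derive c t G) as [D1 D2].
  pose proof (proj1 (G t)) as Hp; unfold H2 in Hp.
  apply (is_derive_ext (fun s => / 2 * (cu N * (fst (c s) ^ 2 + snd (c s) ^ 2) + cw N
                                        - 2 * cv N * fst (c s)))).
  { intros s; pose proof (proj1 (G s)) as Hs; rewrite polar_minkE by exact Hs.
    unfold H2 in Hs; match goal with |- ?x = ?y => change (@eq R x y) end; field; lra. }
  evar_last.
  - apply is_derive_scal, @is_derive_minus; [|apply is_derive_scal; exact D1].
    apply @is_derive_plus; [|apply @is_derive_const].
    apply is_derive_scal, @is_derive_plus; apply is_derive_pow; eassumption.
  - unfold W, minus, plus, opp, zero, scal, mult; cbn -[velocity].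
    unfold plus, mult, opp, zero; cbn -[velocity]; field; lra.
Qed.

(** The quotient of [polar_quotient_derive] is monotone, its derivative having the sign of K, so on
    a segment it is at least its value at one of the ends. The segment may be any solution of the
    geodesic equation. *)
Lemma gconvex_halfplane N : gconvex (fun p => H2 p /\ 0 <= polar (mink p) N).
Proof.
  split; [now intros p []|].
  intros p q z [Hp Np] [Hq Nq] (c & G & <- & <- & t & Ht & ->).
  split; [apply G|].
  assert (Hy : forall s, 0 < snd (c s)) by (intros s; apply (G s)).
  destruct (polar_quotient_derive c N G) as [K D].
  set (r := fun s => polar (mink (c s)) N * snd (c s)) in D.
  assert (Hr : 0 <= r t).
  { destruct (Rle_lt_dec 0 K) as [HK | HK].
    - apply Rle_trans with (r 0); [apply Rmult_le_pos; [exact Np | apply Rlt_le, Hy]|].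
      apply (derive_nonneg_le r (fun s => K * snd (c s) ^ 2)); [lra | intros; apply D; lra|].
      intros; apply Rmult_le_pos; [exact HK | apply pow2_ge_0].
    - apply Rle_trans with (r 1); [apply Rmult_le_pos; [exact Nq | apply Rlt_le, Hy]|].
      enough (- r t <= - r 1) by lra.
      apply (derive_nonneg_le (fun s => - r s) (fun s => - (K * snd (c s) ^ 2))); [lra | |].
      + intros; apply @is_derive_opp, D; lra.
      + intros; pose proof (pow2_ge_0 (snd (c t0))); nra. }
  apply (Rmult_le_reg_r (snd (c t))); [apply Hy | rewrite Rmult_0_l; exact Hr].
Qed.

(** The plane spanned by two points meets the hyperboloid in their geodesic, and nonnegative
    coefficients place the point between them. *)
Lemma gconvex_lin (S : R * R -> Prop) p q z al be : gconvex S -> S p -> S q -> H2 z ->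
  0 <= al -> 0 <= be -> mink z = lin al (mink p) be (mink q) -> S z.
Proof.
  intros [SH SC] Sp Sq Hz Ha Hb Ez.
  pose proof (SH p Sp) as Hp; pose proof (SH q Sq) as Hq.
  destruct (hdist_polar p q Hp Hq) as [Hd Ed]; set (d := hdist p q) in *.
  pose proof (mink_polar z Hz) as Nz; rewrite Ez in Nz.
  rewrite polar_lin_l, !polar_lin_r, (polar_sym (mink q) (mink p)), !mink_polar in Nz by assumption.
  rewrite <- Ed in Nz.
  pose proof (cosh_sqr d) as C; pose proof (sinh_nonneg d Hd) as Hs; pose proof (cosh_pos d) as Hc.
  destruct (Rle_lt_dec d 0) as [Hd0 | Hd0].
  - assert (d = 0) as E0 by lra; rewrite E0, cosh_0 in *.
    destruct (polar_mink_le p q Hp Hq) as [_ Epq]; specialize (Epq (eq_sym Ed)); subst q.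
    assert (al + be = 1) by nra.
    replace z with p; [exact Sp|].
    rewrite <- (proj_mink p Hp), <- (proj_mink z Hz), Ez; f_equal.
    replace al with (1 - be) by lra.
    destruct (mink p); unfold lin; simpl; f_equal; ring.
  - apply (SC p q z Sp Sq).
    set (P := mink p) in *; set (Q := mink q) in *; set (V := frame_dir P Q d).
    assert (HF : frame P V).
    { apply frame_dir_frame; [exact Hd0 | now apply mink_polar | now apply mink_polar | now symmetry
          | now apply cu_mink_pos]. }
    pose proof (sinh_pos d Hd0) as Hs0.
    (* The arc length from p to z: in al P + be Q with Q = cosh d P + sinh d V, the coefficient of V
       is be sinh d. *)
    set (tau := arcsinh (be * sinh d)).
    assert (Etau : sinh tau = be * sinh d) by apply sinh_arcsinh.
    assert (Ctau : cosh tau = al + be * cosh d).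
    { unfold tau; rewrite cosh_arcsinh.
      apply sqrt_lem_1; [nra | nra |].
      transitivity ((al * (1 * al + be * cosh d) + be * (al * cosh d + be * 1))
                    + be ^ 2 * (cosh d * cosh d - 1)); [ring|].
      rewrite C.
      transitivity (1 + be ^ 2 * (sinh d * sinh d)); [|ring].
      replace (1 + sinh d * sinh d - 1) with (sinh d * sinh d) by ring.
      apply Rplus_eq_compat_r; etransitivity; [|exact Nz]; ring. }
    assert (Hbe : be <= 1).
    { assert (0 <= al * be * cosh d) by (apply Rmult_le_pos; [apply Rmult_le_pos|]; lra).
      assert (al * al + be * be + 2 * (al * be * cosh d) = 1) by (etransitivity; [|exact Nz]; ring).
      pose proof (Rle_0_sqr al); unfold Rsqr in *; nra. }
    assert (T0 : 0 <= tau).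
    { rewrite <- arcsinh_0; apply arcsinh_le; nra. }
    assert (T1 : tau <= d).
    { rewrite <- (arcsinh_sinh d); apply arcsinh_le; nra. }
    exists (geoline P V d); split; [|split; [|split]].
    + now apply geoline_geodesic.
    + unfold geoline; rewrite Rmult_0_r, ray_0; now apply proj_mink.
    + unfold geoline, V; rewrite Rmult_1_r, frame_dir_ray by exact Hd0; now apply proj_mink.
    + exists (tau / d); split.
      * split; [apply Rmult_le_pos; [exact T0 | apply Rlt_le, Rinv_0_lt_compat, Hd0]|].
        apply Rle_div_l; lra.
      * unfold geoline; replace (d * (tau / d)) with tau by (field; lra).
        rewrite <- (proj_mink z Hz), Ez; f_equal.
        unfold ray; rewrite Etau, Ctau; unfold V, frame_dir.
        destruct P as [p1 p2 p3], Q as [q1 q2 q3]; unfold lin; cbn [cu cv cw]; f_equal; field; lra.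
Qed.

(** The geodesic from a through z meets the side bc at the normalization of be B + ga C;
    [gconvex_lin] applies first to b and c, then to a and this point. *)
Lemma gconvex_cone (S : R * R -> Prop) a b c z al be ga : gconvex S -> S a -> S b -> S c ->
  H2 z -> 0 < al -> 0 < be -> 0 < ga ->
  mink z = lin al (mink a) 1 (lin be (mink b) ga (mink c)) -> S z.
Proof.
  intros HS Sa Sb Sc Hz Ha Hb Hc Ez.
  pose proof (proj1 HS a Sa) as Ha2; pose proof (proj1 HS b Sb) as Hb2; pose proof (proj1 HS c Sc) as Hc2.
  set (Y := lin be (mink b) ga (mink c)) in *.
  assert (HY : 0 < polar Y Y).
  { unfold Y; rewrite polar_lin_l, !polar_lin_r, (polar_sym (mink c) (mink b)), !mink_polar by assumption.
    destruct (polar_mink_le b c Hb2 Hc2) as [B _]; set (k := polar (mink b) (mink c)) in *.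
    assert (0 < be * be) by nra; assert (0 < ga * ga) by nra.
    assert (0 < be * ga * k) by (apply Rmult_lt_0_compat; [now apply Rmult_lt_0_compat | lra]).
    lra. }
  set (n := sqrt (polar Y Y)); assert (Hn : 0 < n) by now apply sqrt_lt_R0.
  assert (En : n * n = polar Y Y) by (apply sqrt_sqrt; lra).
  set (X := lin (/ n) Y 0 Y).
  assert (HX : polar X X = 1).
  { unfold X; rewrite polar_lin_l, !polar_lin_r, <- En; field; lra. }
  assert (Hu : 0 < cu X).
  { unfold X, Y, lin; cbn [cu].
    pose proof (cu_mink_pos b Hb2); pose proof (cu_mink_pos c Hc2).
    assert (0 < be * cu (mink b) + ga * cu (mink c)) by nra.
    rewrite Rmult_0_l, Rplus_0_r; apply Rmult_lt_0_compat; [now apply Rinv_0_lt_compat | lra]. }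
  assert (EX : mink (proj X) = X) by now apply mink_proj.
  assert (SX : S (proj X)).
  { apply (gconvex_lin S b c (proj X) (/ n * be) (/ n * ga)); try assumption.
    - now apply H2_proj.
    - apply Rlt_le, Rmult_lt_0_compat; [now apply Rinv_0_lt_compat | exact Hb].
    - apply Rlt_le, Rmult_lt_0_compat; [now apply Rinv_0_lt_compat | exact Hc].
    - rewrite EX; unfold X, Y, lin; cbn [cu cv cw]; f_equal; ring. }
  apply (gconvex_lin S a (proj X) z al n); try assumption; try lra.
  rewrite EX, Ez; unfold X, lin; cbn [cu cv cw]; f_equal; field; lra.
Qed.

(** * Cone coordinates of the triangle *)

Definition det3 (A B C : vec) : R :=
  cu A * (cv B * cw C - cw B * cv C) - cv A * (cu B * cw C - cw B * cu C)
  + cw A * (cu B * cv C - cv B * cu C).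

(* Gram's identity: [polar] has determinant [1/4] in these coordinates. *)
Lemma det3_gram A B C k : polar A A = 1 -> polar B B = 1 -> polar C C = 1 ->
  polar A B = k -> polar B C = k -> polar C A = k ->
  det3 A B C ^ 2 = 4 * (k - 1) ^ 2 * (2 * k + 1).
Proof.
  intros E1 E2 E3 E4 E5 E6.
  transitivity (4 * (polar A A * polar B B * polar C C + 2 * polar A B * polar B C * polar C A
    - polar A A * polar B C ^ 2 - polar B B * polar C A ^ 2 - polar C C * polar A B ^ 2)).
  - unfold det3, polar; field.
  - rewrite E1, E2, E3, E4, E5, E6; ring.
Qed.

(* The linear form [det3 _ B C / det3 A B C], represented by [polar]. *)
Definition dual (A B C : vec) : vec :=
  Vec (2 * (cu B * cv C - cv B * cu C) / det3 A B C)
      ((cu B * cw C - cw B * cu C) / det3 A B C)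
      (2 * (cv B * cw C - cw B * cv C) / det3 A B C).

Lemma polar_dual A B C X : det3 A B C <> 0 -> polar X (dual A B C) = det3 X B C / det3 A B C.
Proof. intros H; unfold polar, dual; cbn [cu cv cw]; unfold det3 at 4; field; exact H. Qed.

(** Cramer's rule: pairing with the three duals gives the coordinates in the basis A, B, C. *)
Lemma dual_decomp A B C X : det3 A B C <> 0 ->
  X = lin (polar X (dual A B C)) A 1
        (lin (polar X (dual B C A)) B (polar X (dual C A B)) C).
Proof.
  intros H.
  assert (E1 : det3 B C A = det3 A B C) by (unfold det3; ring).
  assert (E2 : det3 C A B = det3 A B C) by (unfold det3; ring).
  rewrite !polar_dual by congruence; rewrite E1, E2.
  destruct X as [u v w]; unfold lin; cbn [cu cv cw]; f_equal;
    (apply (Rmult_eq_reg_r (det3 A B C)); [|exact H]); field_simplify; [ | exact H | | exact H | | exact H];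
    unfold det3; cbn [cu cv cw]; ring.
Qed.

Lemma open_polar_pos N : open (fun p => H2 p /\ 0 < polar (mink p) N).
Proof.
  apply (open_ext (fun p : R * R => H2 p /\
    0 < cu N * (fst p * fst p + snd p * snd p) + cw N - 2 * cv N * fst p)).
  { intros [x y]; split; intros [Hp H]; (split; [exact Hp|]); rewrite polar_minkE in * by exact Hp;
      unfold H2 in Hp; cbn [fst snd] in *.
    - apply Rdiv_lt_0_compat; lra.
    - pose proof (Rmult_lt_0_compat _ (2 * y) H ltac:(lra)) as H'.
      eapply Rlt_le_trans; [exact H' | right; field; lra]. }
  apply open_and; [exact open_H2|].
  apply (open_comp (fun p : R * R => cu N * (fst p * fst p + snd p * snd p) + cw N - 2 * cv N * fst p)
           (fun y => 0 < y)); [|apply open_gt].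
  intros p _.
  continuity_tac; first [apply continuous_fst | apply continuous_snd].
Qed.

(** Positivity of all three coordinates is an open condition, and [gconvex_cone] puts every point
    satisfying it into each convex set of the intersection. *)
Lemma triangle_interior a b c z al be ga : H2 a -> H2 b -> H2 c ->
  det3 (mink a) (mink b) (mink c) <> 0 -> H2 z -> 0 < al -> 0 < be -> 0 < ga ->
  mink z = lin al (mink a) 1 (lin be (mink b) ga (mink c)) ->
  set_interior (geod_triangle a b c) z.
Proof.
  intros Ha Hb Hc HD Hz Pa Pb Pc Ez.
  set (A := mink a) in *; set (B := mink b) in *; set (C := mink c) in *.
  assert (E1 : det3 B C A = det3 A B C) by (unfold det3; ring).
  assert (E2 : det3 C A B = det3 A B C) by (unfold det3; ring).
  assert (HO : open (fun p => (H2 p /\ 0 < polar (mink p) (dual A B C)) /\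
    (H2 p /\ 0 < polar (mink p) (dual B C A)) /\ (H2 p /\ 0 < polar (mink p) (dual C A B)))).
  { apply open_and; [|apply open_and]; apply open_polar_pos. }
  unfold set_interior.
  refine (filter_imp _ _ _ (HO z _)).
  - intros p ((Hp & K1) & (_ & K2) & (_ & K3)) S HS Sabc.
    apply (gconvex_cone S a b c p _ _ _ HS (Sabc a (or_introl eq_refl))
      (Sabc b (or_intror (or_introl eq_refl))) (Sabc c (or_intror (or_intror eq_refl))) Hp K1 K2 K3).
    now apply dual_decomp.
  - repeat split; try assumption; rewrite polar_dual, Ez by congruence.
    + replace (det3 _ B C) with (al * det3 A B C) by (unfold det3, lin; cbn [cu cv cw]; ring).
      replace (al * det3 A B C / det3 A B C) with al by (field; exact HD); exact Pa.
    + rewrite E1; replace (det3 _ C A) with (be * det3 A B C) by (unfold det3, lin; cbn [cu cv cw]; ring).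
      replace (be * det3 A B C / det3 A B C) with be by (field; exact HD); exact Pb.
    + rewrite E2; replace (det3 _ A B) with (ga * det3 A B C) by (unfold det3, lin; cbn [cu cv cw]; ring).
      replace (ga * det3 A B C / det3 A B C) with ga by (field; exact HD); exact Pc.
Qed.

(** The half-plane on which the coordinate along C is nonnegative is convex and contains the
    vertices, hence the hull. *)
Lemma triangle_exterior a b c z al be ga : H2 a -> H2 b -> H2 c ->
  det3 (mink a) (mink b) (mink c) <> 0 ->
  mink z = lin al (mink a) 1 (lin be (mink b) ga (mink c)) -> ga < 0 ->
  ~ set_interior (geod_triangle a b c) z.
Proof.
  intros Ha Hb Hc HD Ez Hga HI; apply locally_singleton in HI.
  set (A := mink a) in *; set (B := mink b) in *; set (C := mink c) in *.
  assert (E2 : det3 C A B = det3 A B C) by (unfold det3; ring).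
  assert (HD' : det3 C A B <> 0) by congruence.
  destruct (HI _ (gconvex_halfplane (dual C A B))) as [_ K].
  { intros q [-> | [-> | ->]]; (split; [assumption|]); rewrite polar_dual by exact HD'.
    - fold A; replace (det3 A A B) with 0 by (unfold det3; ring); unfold Rdiv; lra.
    - fold B; replace (det3 B A B) with 0 by (unfold det3; ring); unfold Rdiv; lra.
    - fold C; unfold Rdiv; rewrite Rinv_r by exact HD'; lra. }
  rewrite polar_dual, Ez, E2 in K by exact HD'.
  replace (det3 _ A B) with (ga * det3 A B C) in K by (unfold det3, lin; cbn [cu cv cw]; ring).
  replace (ga * det3 A B C / det3 A B C) with ga in K by (field; exact HD); lra.
Qed.

(** * Barriers along geodesics *)

Definition slope (F : R * R -> R) (c : R -> R * R) (t : R) : R :=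
  ginner (c t) (grad F (c t)) (velocity c t).

Definition hess_along (F : R * R -> R) (c : R -> R * R) (t : R) : R :=
  hess F (c t) (velocity c t) (velocity c t).

Lemma barrier_Cn theta D F : is_barrier theta D F -> Cn_on 3 D F.
Proof. intros (_ & _ & _ & H & _) [x y] Dp; exact (H x y Dp). Qed.

Lemma is_derive_F_along D F c t : open D -> Cn_on 3 D F -> is_geodesic c -> D (c t) ->
  is_derive (fun s => F (c s)) t (slope F c t).
Proof.
  intros HD HF G Dt; unfold slope; rewrite ginner_grad by apply G.
  exact (is_derive_along D F 2 c t HD HF G Dt).
Qed.

(** The velocity of a geodesic is parallel, so the third derivative along it is [third_cov] with
    three equal arguments, and the barrier conditions restrict to one variable. *)
Lemma barrier_path theta D F c T : is_barrier theta D F -> is_geodesic c ->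
  (forall t, velocity c t <> (0, 0)) -> (forall t, 0 <= t < T -> D (c t)) ->
  sc_path T (slope F c) (hess_along F c) /\
  forall t, 0 <= t < T -> slope F c t <= sqrt theta * sqrt (hess_along F c t).
Proof.
  intros HB G Hv Hc; pose proof (barrier_Cn _ _ _ HB) as HF.
  destruct HB as (_ & HD & _ & _ & (Hsc & _) & Hpos & Hgrad).
  split; intros t Ht; pose proof (Hc t Ht) as Dt; pose proof (Hpos _ _ Dt (Hv t)) as Hh.
  - split; [|split; [exact Hh|]].
    + apply (is_derive_grad D); try assumption.
      intros p Dp; apply (ex_diff_n_m 3 2); [auto with arith | now apply HF].
    + exists (third_cov F (c t) (velocity c t) (velocity c t) (velocity c t)); split.
      * apply (is_derive_hess_parallel D); try assumption; now apply parallel_velocity.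
      * now apply Hsc.
  - apply Rle_div_l; [now apply sqrt_lt_R0 | now apply Hgrad].
Qed.

Lemma geodesic_continuous c t : is_geodesic c -> continuous c t.
Proof.
  intros G; destruct (geodesic_derive c t G) as [D1 D2].
  apply (continuous_ext (fun s => (fst (c s), snd (c s)))).
  { intros s; symmetry; apply surjective_pairing. }
  apply (continuous_comp_2 (fun s => fst (c s)) (fun s => snd (c s)) (fun x y => (x, y))).
  - apply (ex_derive_continuous (V := R_NormedModule)); eexists; exact D1.
  - apply (ex_derive_continuous (V := R_NormedModule)); eexists; exact D2.
  - apply (continuous_ext (fun z => z)); [intros []; reflexivity | apply continuous_id].
Qed.

(* A bounded [F] cannot leave [D], because its epigraph is closed; self-concordance keeps [F]
   bounded up to time [1 / sqrt h]. *)
Lemma barrier_exit theta D F c w : is_barrier theta D F -> is_geodesic c ->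
  (forall t, velocity c t <> (0, 0)) -> 0 < w -> D (c 0) -> ~ D (c w) ->
  1 <= w * sqrt (hess_along F c 0).
Proof.
  intros HB G Hv Hw D0 Dw; apply Rnot_lt_le; intros Hlt.
  pose proof (barrier_Cn _ _ _ HB) as HF.
  assert (HD : open D) by apply HB.
  set (E := fun t => 0 <= t <= w /\ forall s, 0 <= s <= t -> D (c s)).
  destruct (completeness E) as [T [Tub Tlub]].
  { exists w; intros t [Ht _]; lra. }
  { exists 0; split; [lra|]; intros s Hs; replace s with 0 by lra; exact D0. }
  assert (T0 : 0 <= T).
  { apply Tub; split; [lra|]; intros s Hs; replace s with 0 by lra; exact D0. }
  assert (Tw : T <= w) by (apply Tlub; intros t [Ht _]; lra).
  assert (Hin : forall t, 0 <= t < T -> D (c t)).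
  { intros t Ht; apply NNPP; intros Hn.
    enough (T <= t) by lra; apply Tlub; intros u [Hu HuD].
    apply Rnot_lt_le; intros K; apply Hn, HuD; lra. }
  assert (DT : D (c T)).
  { destruct T0 as [T0 | <-]; [|exact D0].
    destruct (barrier_path theta D F c T HB G Hv Hin) as [SC _].
    destruct (sc_path_bounded T (fun s => F (c s)) _ _ T0 SC) as [M HM].
    { intros t Ht; apply (is_derive_F_along D); auto. }
    { destruct (barrier_path theta D F c T HB G Hv Hin) as [SC0 _].
      destruct (SC0 0) as (_ & Hh & _); [lra|].
      pose proof (sqrt_lt_R0 _ Hh); nra. }
    assert (HCl : closed_in_H2xR (epigraph D F)) by apply HB.
    destruct HCl as (C & HC & EC).
    enough (epigraph D F (c T, M)) as [K _] by exact K.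
    apply EC; split; [apply G|]; apply HC.
    (* Closedness is used in the form that no ball around (c T, M) misses C; a slightly earlier
       point of the curve, at the same height M, refutes such a ball. *)
    intros [e He].
    destruct (geodesic_continuous c T G (ball (c T) e) (locally_ball (c T) e)) as [d Hd].
    set (t := T - Rmin d T / 2).
    assert (Hm : 0 < Rmin d T) by (apply Rmin_pos; [apply cond_pos | exact T0]).
    pose proof (Rmin_l d T); pose proof (Rmin_r d T).
    assert (Ht : 0 <= t < T) by (unfold t; lra).
    apply (He (c t, M)).
    - split; [|apply ball_center]; simpl fst; apply Hd.
      change (Rabs (t - T) < d); unfold t; rewrite Rabs_left; lra.
    - apply EC; split; [now apply Hin | now apply HM]. }
  (* Openness now carries the curve past T, against the choice of T as a supremum, unless w is
     already reached. *)
  destruct (geodesic_continuous c T G D (HD _ DT)) as [d Hd].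
  pose proof (cond_pos d) as Hd0.
  assert (Hnear : forall s, 0 <= s < T + d -> D (c s)).
  { intros s Hs; destruct (Rlt_le_dec s T); [apply Hin; lra|].
    apply Hd; change (Rabs (s - T) < d); rewrite Rabs_pos_eq; lra. }
  destruct (Rle_lt_dec w (T + d / 2)) as [K | K]; [apply Dw, Hnear; lra|].
  enough (T + d / 2 <= T) by lra.
  apply Tub; split; [lra|]; intros s Hs; apply Hnear; lra.
Qed.

Lemma geoline_0 P V d : geoline P V d 0 = proj P.
Proof. unfold geoline; now rewrite Rmult_0_r, ray_0. Qed.

Lemma velocity_geoline_0 P V : frame P V -> velocity (geoline P V 1) 0 = dproj (proj P) V.
Proof.
  intros HF; rewrite velocity_dproj, geoline_0, Rmult_0_r, ray_0 by exact HF; reflexivity.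
Qed.

Lemma velocity_neq_0 P V t : frame P V -> velocity (geoline P V 1) t <> (0, 0).
Proof.
  intros HF E; pose proof (geoline_speed P V 1 t HF) as K; rewrite E in K.
  unfold ginner, sum2 in K; simpl in K; lra.
Qed.

Definition vopp (V : vec) : vec := Vec (- cu V) (- cv V) (- cw V).

Lemma frame_vopp P V : frame P V -> frame P (vopp V).
Proof.
  intros (E1 & E2 & E3 & H); repeat split; try assumption; unfold polar, vopp in *; cbn [cu cv cw]; lra.
Qed.

Definition hess_frame (F : R * R -> R) (P V : vec) : R :=
  hess F (proj P) (dproj (proj P) V) (dproj (proj P) V).

Lemma hess_along_0 F P V : frame P V -> hess_along F (geoline P V 1) 0 = hess_frame F P V.
Proof.
  intros HF; unfold hess_along, hess_frame.
  now rewrite velocity_geoline_0, geoline_0 by exact HF.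
Qed.

(** [sc_path_hessian_bound] needs a nonnegative initial slope. One of [V] and [vopp V] has it, and
    the Hessian does not see the sign. *)
Lemma barrier_width theta D F P V r : is_barrier theta D F -> frame P V -> 0 < r ->
  (forall t, 0 <= t < r -> D (geoline P V 1 t) /\ D (geoline P (vopp V) 1 t)) ->
  r * sqrt (hess_frame F P V) <= theta + 2 * sqrt theta.
Proof.
  intros HB HF Hr Hin.
  assert (K : forall U, frame P U -> (forall t, 0 <= t < r -> D (geoline P U 1 t)) ->
     0 <= ginner (proj P) (grad F (proj P)) (dproj (proj P) U) ->
     r * sqrt (hess_frame F P U) <= theta + 2 * sqrt theta).
  { intros U HU HD Hs.
    destruct (barrier_path theta D F (geoline P U 1) r HB (geoline_geodesic P U 1 HU)
       (fun t => velocity_neq_0 P U t HU) HD) as [SC B].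
    rewrite <- hess_along_0 by exact HU.
    apply (sc_path_hessian_bound r (slope F (geoline P U 1))); try assumption; [apply HB|].
    unfold slope; now rewrite velocity_geoline_0, geoline_0 by exact HU. }
  pose proof (frame_vopp P V HF) as HF'.
  destruct (Rle_lt_dec 0 (ginner (proj P) (grad F (proj P)) (dproj (proj P) V))) as [Hs | Hs].
  - apply K; [exact HF | intros t Ht; now apply Hin | exact Hs].
  - replace (hess_frame F P V) with (hess_frame F P (vopp V)).
    + apply K; [exact HF' | intros t Ht; now apply Hin|].
      apply Rlt_le; eapply Rlt_le_trans; [apply Ropp_0_gt_lt_contravar; exact Hs|].
      right; unfold ginner, sum2, dproj, vopp; simpl; ring.
    + unfold hess_frame, hess, sum2, dproj, vopp; simpl; ring.
Qed.

(** By [parallel_normal] the same vector [N] is the parallel normal at both ends. Self-concordance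
    is applied with the velocity in the first slot and the normal in the other two, which bounds the
    derivative of the normal Hessian by itself times 2 sqrt h. *)
Lemma log_hess_growth theta D F P V N s : is_barrier theta D F ->
  frame P V -> polar P N = 0 -> polar V N = 0 -> polar N N = -1 -> 0 <= s ->
  (forall t, 0 <= t <= s -> D (geoline P V 1 t)) ->
  ln (hess_frame F (ray P V s) N) - ln (hess_frame F P N)
    <= slope F (geoline P V 1) s - slope F (geoline P V 1) 0 + s.
Proof.
  intros HB HF HP HV HN Hs Hin.
  set (c := geoline P V 1).
  set (n := fun t => dproj (c t) N).
  set (k := fun t => hess F (c t) (n t) (n t)).
  pose proof (geoline_geodesic P V 1 HF) as G.
  pose proof (barrier_Cn _ _ _ HB) as HFC.
  assert (Hc : forall t, c t = proj (ray P V t)) by (intros t; unfold c, geoline; now rewrite Rmult_1_l).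
  assert (Ek : forall t, hess_frame F (ray P V t) N = k t) by (intros t; unfold k, n; now rewrite Hc).
  rewrite <- (ray_0 P V) at 2; rewrite !Ek.
  assert (Hn : forall t, n t <> (0, 0)).
  { intros t; unfold n; rewrite Hc.
    assert (HFt : frame (ray P V t) N).
    { repeat split; [now apply frame_ray_polar | unfold ray; rewrite polar_lin_l, HP, HV; ring
        | exact HN | now apply frame_ray_pos]. }
    rewrite <- velocity_geoline_0 by exact HFt; now apply velocity_neq_0. }
  destruct HB as (_ & HD & _ & _ & (Hsc & _) & Hpos & _).
  assert (Hk : forall t, 0 <= t <= s -> 0 < k t) by (intros t Ht; exact (Hpos (c t) (n t) (Hin t Ht) (Hn t))).
  assert (Dk : forall t, 0 <= t <= s -> is_derive k t (third_cov F (c t) (velocity c t) (n t) (n t))).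
  { intros t Ht.
    exact (is_derive_hess_parallel D F c n t HD HFC G (Hin t Ht) (parallel_normal P V N HF HP HV)). }
  replace (slope F c s - slope F c 0 + s) with ((slope F c s + s) - (slope F c 0 + 0)) by ring.
  apply (derive_le_sub_le (fun t => ln (k t)) (fun t => slope F c t + t)
     (fun t => third_cov F (c t) (velocity c t) (n t) (n t) * / k t)
     (fun t => hess_along F c t + 1)); [exact Hs | | |]; intros t Ht.
  - apply (is_derive_comp ln k); [|now apply Dk].
    apply is_derive_Reals, derivable_pt_lim_ln; now apply Hk.
  - apply @is_derive_plus; [|apply @is_derive_id].
    refine (is_derive_grad D F c t HD _ G (Hin t Ht)).
    intros p Dp; apply (ex_diff_n_m 3 2); [auto with arith | now apply HFC].
  - specialize (Hk t Ht).
    assert (Hh : 0 < hess_along F c t) 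
      by exact (Hpos (c t) (velocity c t) (Hin t Ht) (velocity_neq_0 P V t HF)).
    pose proof (Hsc (c t) (velocity c t) (n t) (n t) (Hin t Ht)) as B.
    apply Rabs_le_between in B; fold (k t) (hess_along F c t) in B.
    rewrite (Rmult_assoc _ (sqrt (k t))), sqrt_sqrt in B by lra.
    apply Rle_div_l; [exact Hk|].
    pose proof (sqrt_sqrt (hess_along F c t) (Rlt_le _ _ Hh)).
    assert (2 * sqrt (hess_along F c t) <= hess_along F c t + 1).
    { pose proof (pow2_ge_0 (sqrt (hess_along F c t) - 1)); nra. }
    nra.
Qed.

(** * The equilateral triangle *)

Lemma sinh_minus a b : sinh (a - b) = sinh a * cosh b - cosh a * sinh b.
Proof.
  unfold sinh, cosh; replace (- (a - b)) with (- a + b) by ring.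
  unfold Rminus at 2; rewrite !exp_plus; field.
Qed.

Lemma cosh_double t : cosh t = 1 + 2 * sinh (t / 2) ^ 2.
Proof.
  unfold cosh, sinh.
  replace (exp t) with (exp (t / 2) * exp (t / 2)) by (rewrite <- exp_plus; f_equal; field).
  replace (exp (- t)) with (exp (- (t / 2)) * exp (- (t / 2))) by (rewrite <- exp_plus; f_equal; field).
  assert (E : exp (t / 2) * exp (- (t / 2)) = 1) by (rewrite <- exp_plus, Rplus_opp_r; apply exp_0).
  nra.
Qed.

(* The concavity of [tanh], without division. *)
Lemma tanh_concave l w : 0 <= l <= 1 -> 0 <= w ->
  l * (sinh w * cosh (l * w)) <= cosh w * sinh (l * w).
Proof.
  intros Hl Hw.
  set (f := fun x => cosh x * sinh (l * x) - l * (sinh x * cosh (l * x))).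
  assert (K : f 0 <= f w).
  { apply (derive_nonneg_le f (fun x => (1 - l ^ 2) * (sinh x * sinh (l * x)))); [exact Hw | |]; intros x Hx.
    - unfold f; auto_derive; [easy | ring].
    - apply Rmult_le_pos; [nra|]; apply Rmult_le_pos; apply sinh_nonneg; nra. }
  unfold f in K; rewrite Rmult_0_r, sinh_0 in K; lra.
Qed.

(** The tangent of [ln] at e^(1/2), its slope e^(-1/2) rounded up by e^(1/2) >= 3/2. *)
Lemma ln_le_affine Q : 0 < Q -> ln Q <= 2 / 3 * Q - 1 / 2.
Proof.
  intros HQ.
  assert (He : exp (- (1 / 2)) <= 2 / 3).
  { rewrite exp_Ropp; replace (2 / 3) with (/ (3 / 2)) by field.
    apply Rinv_le_contravar; [lra|]; pose proof (exp_ineq1_le (1 / 2)); lra. }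
  pose proof (exp_ineq1_le (ln Q - 1 / 2)) as K.
  replace (ln Q - 1 / 2) with (ln Q + - (1 / 2)) in K by ring.
  rewrite exp_plus, exp_ln in K by exact HQ.
  pose proof (exp_pos (- (1 / 2))); nra.
Qed.

Lemma final_estimate theta L p : 0 <= theta -> 0 < theta + 2 * sqrt theta ->
  (L / 2 - L / 4) * p <= theta -> L / 4 - 2 * ln (theta + 2 * sqrt theta) <= p ->
  L / 12 - 1 / 6 <= theta.
Proof.
  intros Hth HQ H1 H2; apply Rnot_lt_le; intros Hlt.
  pose proof (ln_le_affine _ HQ) as HL.
  pose proof (sqrt_pos theta) as Hu; pose proof (sqrt_sqrt theta Hth) as Eu.
  set (u := sqrt theta) in *.
  (* If the claim fails then L/4 > 3 theta + 1/2, so with u = sqrt theta the affine bound gives p >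
     5/3 u^2 - 8/3 u + 3/2, with minimum 13/30 at u = 4/5. Then (L/4) p exceeds L/12, hence
     theta. *)
  assert (Hp : 1 / 3 < p).
  { enough (0 < 5 / 3 * (u * u) - 8 / 3 * u + 7 / 6) by lra.
    pose proof (Rle_0_sqr (u - 4 / 5)) as S; unfold Rsqr in S; nra. }
  nra.
Qed.

Lemma triangle_rotate a b c z :
  geod_triangle a b c z -> geod_triangle b c a z.
Proof. intros H S HS HA; apply H; [exact HS|]; intros q [-> | [-> | ->]]; apply HA; auto. Qed.

(** A + B + C normalized: its [polar] square is 3 + 6 k when the vertices have mutual products k. *)
Definition center (k : R) (A B C : vec) : vec :=
  lin (/ sqrt (3 + 6 * k)) A 1 (lin (/ sqrt (3 + 6 * k)) B (/ sqrt (3 + 6 * k)) C).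

(** From cosh rho = [polar O A] = (1 + 2 k) / sqrt (3 + 6 k) one gets sinh rho ^ 2 = 2 (k - 1) /
    3. *)
Definition circumradius (k : R) : R := arcsinh (sqrt (2 * (k - 1) / 3)).

Lemma sinh_circumradius k : 1 < k ->
  0 < circumradius k /\ sinh (circumradius k) ^ 2 = 2 * (k - 1) / 3 /\
  cosh (circumradius k) = sqrt (3 + 6 * k) / 3.
Proof.
  intros Hk.
  assert (E : sinh (circumradius k) = sqrt (2 * (k - 1) / 3)) by apply sinh_arcsinh.
  split; [|split].
  - unfold circumradius; rewrite <- arcsinh_0; apply arcsinh_lt, sqrt_lt_R0; lra.
  - rewrite E, pow2_sqrt; lra.
  - unfold circumradius; rewrite cosh_arcsinh, pow2_sqrt by lra.
    apply sqrt_lem_1; [lra | pose proof (sqrt_pos (3 + 6 * k)); lra |].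
    replace (sqrt (3 + 6 * k) / 3 * (sqrt (3 + 6 * k) / 3))
      with (sqrt (3 + 6 * k) * sqrt (3 + 6 * k) / 9) by field.
    rewrite sqrt_sqrt; lra.
Qed.

(** As cosh L - 1 = 2 sinh (L/2)^2, the square of sinh rho is 4/3 of that of sinh (L/2). *)
Lemma circumradius_ge L : 0 < L -> L / 2 <= circumradius (cosh L).
Proof.
  intros HL; pose proof (cosh_double L) as E.
  pose proof (sinh_pos (L / 2) ltac:(lra)) as Hs.
  assert (Hk : 1 < cosh L) by nra.
  destruct (sinh_circumradius _ Hk) as (HR & ER & _).
  apply Rnot_lt_le; intros Hlt; apply sinh_lt in Hlt.
  pose proof (sinh_pos _ HR); nra.
Qed.

Section Equilateral.

Variables (k : R) (A B C : vec).
Hypotheses (Hk : 1 < k)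
  (EA : polar A A = 1) (EB : polar B B = 1) (EC : polar C C = 1)
  (EAB : polar A B = k) (EBC : polar B C = k) (ECA : polar C A = k)
  (HA : 0 < cu A) (HB : 0 < cu B) (HC : 0 < cu C).

Let n := sqrt (3 + 6 * k).
Let nu := sqrt (2 * k - 2).
Let O := center k A B C.
Let rho := circumradius k.
Let V := frame_dir O A rho.

(* The unit normal of the altitude from [A], in the direction of the opposite side. *)
Definition side_dir (k : R) (B C : vec) : vec :=
  lin (/ sqrt (2 * k - 2)) B (- / sqrt (2 * k - 2)) C.

Let M := side_dir k B C.

(** The common coordinate along B and C of the altitude at time t; it vanishes at t = rho, where the
    altitude reaches A. *)
Definition alt_coef (t : R) : R := sinh (rho - t) / (n * sinh rho).

Lemma n_pos : 0 < n /\ n * n = 3 + 6 * k.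
Proof. split; [apply sqrt_lt_R0 | apply sqrt_sqrt]; lra. Qed.

Lemma nu_pos : 0 < nu /\ nu * nu = 2 * k - 2.
Proof. split; [apply sqrt_lt_R0 | apply sqrt_sqrt]; lra. Qed.

Lemma rho_pos : 0 < rho /\ 0 < sinh rho /\ cosh rho = n / 3.
Proof.
  destruct (sinh_circumradius k Hk) as (H1 & _ & H3).
  split; [exact H1 | split; [now apply sinh_pos | exact H3]].
Qed.

Lemma center_frame : frame O V.
Proof.
  destruct n_pos as [Hn En]; destruct rho_pos as (H1 & _ & H3).
  apply frame_dir_frame; [exact H1 | | exact EA | |].
  - unfold O, center; fold n; rewrite !polar_lin_l, !polar_lin_r.
    rewrite (polar_sym B A), (polar_sym C B), (polar_sym A C), EA, EB, EC, EAB, EBC, ECA.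
    transitivity ((3 + 6 * k) / (n * n)); [field; lra | rewrite <- En; field; lra].
  - unfold O, center; fold n; rewrite !polar_lin_l.
    rewrite (polar_sym B A), EA, EAB, ECA, H3.
    transitivity ((3 + 6 * k) / (3 * n)); [field; lra | rewrite <- En; field; lra].
  - unfold O, center; fold n; unfold lin; cbn [cu].
    pose proof (Rinv_0_lt_compat n Hn).
    assert (0 < / n * cu A) by now apply Rmult_lt_0_compat.
    assert (0 < / n * cu B) by now apply Rmult_lt_0_compat.
    assert (0 < / n * cu C) by now apply Rmult_lt_0_compat.
    lra.
Qed.

Lemma side_orth : polar O M = 0 /\ polar V M = 0 /\ polar M M = -1.
Proof.
  destruct n_pos as [Hn En]; destruct nu_pos as [Hnu Enu].
  assert (E1 : polar O M = 0).
  { unfold O, center, M, side_dir; fold n nu; rewrite !polar_lin_l, !polar_lin_r.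
    rewrite (polar_sym A C), (polar_sym C B), EB, EC, EAB, EBC, ECA; ring. }
  split; [exact E1 | split].
  - unfold V, frame_dir; rewrite polar_lin_l, E1.
    unfold M, side_dir; rewrite polar_lin_r, (polar_sym A C), EAB, ECA; ring.
  - unfold M, side_dir; fold nu; rewrite !polar_lin_l, !polar_lin_r.
    rewrite (polar_sym C B), EB, EC, EBC.
    transitivity (- (2 * k - 2) / (nu * nu)); [field; lra | rewrite <- Enu; field; lra].
Qed.

Lemma altitude_frame t : frame (ray O V t) M.
Proof.
  destruct side_orth as (E1 & E2 & E3); pose proof center_frame as HF.
  repeat split; [now apply frame_ray_polar | | exact E3 | now apply frame_ray_pos].
  unfold ray; rewrite polar_lin_l, E1, E2; ring.
Qed.

Lemma altitude_coords t :
  ray O V t = lin (cosh t / n + 2 * sinh t / (3 * sinh rho)) A 1 (lin (alt_coef t) B (alt_coef t) C).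
Proof.
  destruct n_pos as [Hn En]; destruct rho_pos as (H1 & H2 & H3).
  unfold alt_coef, ray, V, frame_dir, O, center; fold n.
  rewrite sinh_minus, H3.
  unfold lin; cbn [cu cv cw]; f_equal; field; lra.
Qed.

(** On the geodesic leaving the altitude at right angles, B gains what C loses, so the exit through
    the side AB is the zero of the last coefficient. *)
Lemma transversal_coords t s :
  ray (ray O V t) M s =
    lin (cosh s * (cosh t / n + 2 * sinh t / (3 * sinh rho))) A 1
      (lin (cosh s * alt_coef t + sinh s / nu) B (cosh s * alt_coef t - sinh s / nu) C).
Proof.
  destruct nu_pos as [Hnu _]; destruct n_pos as [Hn _]; destruct rho_pos as (_ & Hr & _).
  rewrite altitude_coords; unfold M, side_dir; fold nu.
  unfold ray, lin; cbn [cu cv cw]; f_equal; field; lra.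
Qed.

Lemma alt_coef_0 : alt_coef 0 = / n.
Proof.
  destruct n_pos as [Hn _]; destruct rho_pos as (_ & H2 & _).
  unfold alt_coef; rewrite Rminus_0_r; field; lra.
Qed.

Lemma alt_coef_pos t : t < rho -> 0 < alt_coef t.
Proof.
  intros Ht; destruct n_pos as [Hn _]; destruct rho_pos as (_ & H2 & _).
  apply Rdiv_lt_0_compat; [apply sinh_pos; lra | now apply Rmult_lt_0_compat].
Qed.

(** Expanding sinh (rho - t) and replacing cosh rho by the smaller sinh rho leaves sinh rho (cosh t
    - sinh t). *)
Lemma alt_coef_decay t : 0 < t -> alt_coef t < exp (- t) / n.
Proof.
  intros Ht; destruct n_pos as [Hn _]; destruct rho_pos as (H1 & H2 & _).
  unfold alt_coef; replace (exp (- t) / n) with (exp (- t) * sinh rho / (n * sinh rho)) by (field; lra).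
  apply Rmult_lt_compat_r; [apply Rinv_0_lt_compat; now apply Rmult_lt_0_compat|].
  rewrite sinh_minus, exp_opp_cosh.
  pose proof (sinh_pos t Ht); pose proof (exp_opp_cosh rho); pose proof (exp_pos (- rho)); nra.
Qed.

(** The exit time w at the center solves tanh w = nu / n, and n^2 - nu^2 = 4 k + 5. *)
Definition half_width : R := arcsinh (nu / sqrt (4 * k + 5)).

Lemma half_width_spec : 0 < half_width /\ n * sinh half_width = nu * cosh half_width.
Proof.
  destruct n_pos as [Hn En]; destruct nu_pos as [Hnu Enu].
  assert (Hm : 0 < sqrt (4 * k + 5)) by (apply sqrt_lt_R0; lra).
  assert (Em : sqrt (4 * k + 5) * sqrt (4 * k + 5) = 4 * k + 5) by (apply sqrt_sqrt; lra).
  unfold half_width; set (m := sqrt (4 * k + 5)) in *.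
  split; [rewrite <- arcsinh_0; apply arcsinh_lt; now apply Rdiv_lt_0_compat|].
  rewrite sinh_arcsinh, cosh_arcsinh.
  replace (sqrt (1 + (nu / m) ^ 2)) with (n / m); [field; lra|].
  symmetry; apply sqrt_lem_1.
  - pose proof (pow2_ge_0 (nu / m)); lra.
  - apply Rlt_le; now apply Rdiv_lt_0_compat.
  - transitivity ((n * n) / (m * m)); [field; lra|].
    transitivity ((m * m + nu * nu) / (m * m)); [|field; lra].
    f_equal; lra.
Qed.

Lemma half_width_inside s : 0 <= s < half_width -> 0 < cosh s / n - sinh s / nu.
Proof.
  intros Hs; destruct half_width_spec as [Hw Ew].
  destruct n_pos as [Hn _]; destruct nu_pos as [Hnu _].
  pose proof (sinh_pos (half_width - s) ltac:(lra)) as P; rewrite sinh_minus in P.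
  pose proof (sinh_pos _ Hw) as Ps.
  replace (cosh s / n - sinh s / nu) with ((nu * cosh s - n * sinh s) / (n * nu)) by (field; lra).
  apply Rdiv_lt_0_compat; [|now apply Rmult_lt_0_compat].
  apply (Rmult_lt_reg_l (sinh half_width)); [exact Ps|].
  rewrite Rmult_0_r.
  replace (sinh half_width * (nu * cosh s - n * sinh s))
    with (nu * (sinh half_width * cosh s) - n * sinh half_width * sinh s) by ring.
  rewrite Ew.
  replace (nu * (sinh half_width * cosh s) - nu * cosh half_width * sinh s)
    with (nu * (sinh half_width * cosh s - cosh half_width * sinh s)) by ring.
  now apply Rmult_lt_0_compat.
Qed.

(** With l = e^(-t), the coordinate along C is negative once tanh (l w) > nu [alt_coef t]. This
    holds as nu [alt_coef t] < l nu / n = l tanh w <= tanh (l w), by concavity of tanh. *)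
Lemma half_width_outside t : 0 < t ->
  cosh (exp (- t) * half_width) * alt_coef t - sinh (exp (- t) * half_width) / nu < 0.
Proof.
  intros Ht; destruct half_width_spec as [Hw Ew].
  destruct n_pos as [Hn _]; destruct nu_pos as [Hnu _].
  pose proof (alt_coef_decay t Ht) as D; pose proof (exp_pos (- t)) as He.
  assert (He1 : exp (- t) <= 1).
  { rewrite <- exp_0; destruct (Req_dec (- t) 0) as [-> | ]; [lra|]; apply Rlt_le, exp_increasing; lra. }
  set (l := exp (- t)) in *; set (s := l * half_width).
  pose proof (tanh_concave l half_width ltac:(lra) ltac:(lra)) as T; fold s in T.
  pose proof (cosh_pos s) as Cs; pose proof (cosh_pos half_width) as Cw.
  assert (K : l * cosh s / n <= sinh s / nu).
  { replace (l * cosh s / n) with (nu * (l * cosh s) / (n * nu)) by (field; lra).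
    replace (sinh s / nu) with (n * sinh s / (n * nu)) by (field; lra).
    apply Rmult_le_compat_r; [apply Rlt_le, Rinv_0_lt_compat; now apply Rmult_lt_0_compat|].
    apply (Rmult_le_reg_l (cosh half_width)); [exact Cw|].
    replace (cosh half_width * (nu * (l * cosh s))) with (nu * cosh half_width * (l * cosh s)) by ring.
    rewrite <- Ew.
    replace (n * sinh half_width * (l * cosh s)) with (n * (l * (sinh half_width * cosh s))) by ring.
    replace (cosh half_width * (n * sinh s)) with (n * (cosh half_width * sinh s)) by ring.
    apply Rmult_le_compat_l; lra. }
  assert (cosh s * alt_coef t < cosh s * (l / n)) by now apply Rmult_lt_compat_l.
  replace (cosh s * (l / n)) with (l * cosh s / n) in * by (field; lra); lra.
Qed.

End Equilateral.

(** * The bound from one vertex, and the choice of the vertex *)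

(** [D] is tied to the triangle only by an equivalence, so the vertices can be rotated while the
    domain of the barrier stays the same predicate. *)
Lemma vertex_bound theta D F L a b c : 0 < L -> H2 a -> H2 b -> H2 c ->
  polar (mink a) (mink b) = cosh L -> polar (mink b) (mink c) = cosh L ->
  polar (mink c) (mink a) = cosh L ->
  (forall z, D z <-> set_interior (geod_triangle a b c) z) -> is_barrier theta D F ->
  (let O := center (cosh L) (mink a) (mink b) (mink c) in
   0 <= ginner (proj O) (grad F (proj O))
          (dproj (proj O) (frame_dir O (mink a) (circumradius (cosh L))))) ->
  L / 12 - 1 / 6 <= theta.
Proof.
  intros HL Ha Hb Hc Eab Ebc Eca HD HBar Hgrad.
  assert (Hk : 1 < cosh L).
  { rewrite cosh_double; pose proof (sinh_pos (L / 2) ltac:(lra)); nra. }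
  pose proof (circumradius_ge L HL) as HR.
  set (k := cosh L) in *; set (A := mink a) in *; set (B := mink b) in *; set (C := mink c) in *.
  assert (EA : polar A A = 1) by now apply mink_polar.
  assert (EB : polar B B = 1) by now apply mink_polar.
  assert (EC : polar C C = 1) by now apply mink_polar.
  assert (UA : 0 < cu A) by now apply cu_mink_pos.
  assert (UB : 0 < cu B) by now apply cu_mink_pos.
  assert (UC : 0 < cu C) by now apply cu_mink_pos.
  assert (Hdet : det3 A B C <> 0).
  { intros E; pose proof (det3_gram A B C k EA EB EC Eab Ebc Eca) as G; rewrite E in G.
    assert (0 < (k - 1) ^ 2) by (apply pow_lt; lra); nra. }
  set (O := center k A B C) in *; set (rho := circumradius k) in *.
  set (V := frame_dir O A rho) in *; set (M := side_dir k B C).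
  assert (HF : frame O V) by now apply center_frame.
  assert (HFM : forall t, frame (ray O V t) M) by (intros t; now apply altitude_frame).
  destruct (side_orth k A B C Hk EB EC Eab Ebc Eca) as (OM & VM & MM).
  fold O M in OM; fold O rho V M in VM; fold M in MM.
  destruct (half_width_spec k Hk) as [Hw _]; set (w := half_width k) in *.
  set (al := fun t => cosh t / sqrt (3 + 6 * k) + 2 * sinh t / (3 * sinh rho)).
  assert (Hal : forall t, 0 <= t -> 0 < al t).
  { intros t Ht; destruct (rho_pos k Hk) as (_ & Hs & _); destruct (n_pos k Hk) as [Hn _].
    fold rho in Hs; unfold al; apply Rplus_lt_le_0_compat.
    - apply Rdiv_lt_0_compat; [apply cosh_pos | exact Hn].
    - apply Rmult_le_pos; [pose proof (sinh_nonneg t Ht); lra | apply Rlt_le, Rinv_0_lt_compat; lra]. }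
  assert (Hin : forall z x y v, H2 z -> 0 < x -> 0 < y -> 0 < v ->
            mink z = lin x A 1 (lin y B v C) -> D z).
  { intros z x y v Hz Hx Hy Hv Ez; apply HD; now apply (triangle_interior a b c z x y v). }
  assert (Halt : forall t, 0 <= t < rho -> D (geoline O V 1 t)).
  { intros t Ht; apply (Hin _ (al t) (alt_coef k t) (alt_coef k t)).
    - now apply H2_geoline.
    - apply Hal; lra.
    - apply alt_coef_pos; [exact Hk | apply Ht].
    - apply alt_coef_pos; [exact Hk | apply Ht].
    - rewrite mink_geoline, Rmult_1_l by exact HF; now apply altitude_coords. }
  assert (HQ : w * sqrt (hess_frame F O M) <= theta + 2 * sqrt theta).
  { pose proof (HFM 0) as HF0; rewrite ray_0 in HF0.
    apply (barrier_width theta D F O M w HBar HF0 Hw).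
    intros t Ht.
    pose proof (half_width_inside k Hk t Ht) as Hc1.
    pose proof (transversal_coords k A B C Hk 0) as TC; fold O rho V M in TC; rewrite ray_0 in TC.
    rewrite alt_coef_0 in TC by exact Hk.
    pose proof (sinh_nonneg t (proj1 Ht)) as Hst; destruct (nu_pos k Hk) as [Hnu _].
    pose proof (cosh_pos t) as Hct; pose proof (Hal 0 ltac:(lra)) as Ha0.
    assert (0 <= sinh t / sqrt (2 * k - 2)) by (apply Rmult_le_pos; [exact Hst | now apply Rlt_le, Rinv_0_lt_compat]).
    assert (0 < cosh t * al 0) by now apply Rmult_lt_0_compat.
    split.
    - apply (Hin _ (cosh t * al 0) (cosh t / sqrt (3 + 6 * k) + sinh t / sqrt (2 * k - 2))
               (cosh t / sqrt (3 + 6 * k) - sinh t / sqrt (2 * k - 2))); try lra.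
      + now apply H2_geoline.
      + rewrite mink_geoline, Rmult_1_l by exact HF0; exact (TC t).
    - apply (Hin _ (cosh t * al 0) (cosh t / sqrt (3 + 6 * k) - sinh t / sqrt (2 * k - 2))
               (cosh t / sqrt (3 + 6 * k) + sinh t / sqrt (2 * k - 2))); try lra.
      + now apply H2_geoline, frame_vopp.
      + rewrite mink_geoline, Rmult_1_l by now apply frame_vopp.
        transitivity (ray O M (- t)).
        * unfold ray, vopp, lin; cbn [cu cv cw].
          replace (cosh (- t)) with (cosh t) by (unfold cosh; rewrite Ropp_involutive; field).
          replace (sinh (- t)) with (- sinh t) by (unfold sinh; rewrite Ropp_involutive; field).
          f_equal; ring.
        * rewrite TC.
          replace (cosh (- t)) with (cosh t) by (unfold cosh; rewrite Ropp_involutive; field).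
          replace (sinh (- t)) with (- sinh t) by (unfold sinh; rewrite Ropp_involutive; field).
          unfold al, Rdiv; f_equal; f_equal; ring. }
  set (s := L / 4); assert (Hs : 0 < s) by (unfold s; lra).
  assert (HX : 1 <= exp (- s) * w * sqrt (hess_frame F (ray O V s) M)).
  { rewrite <- hess_along_0 by apply HFM.
    apply (barrier_exit theta D F); try assumption.
    - apply geoline_geodesic, HFM.
    - intros t; apply velocity_neq_0, HFM.
    - apply Rmult_lt_0_compat; [apply exp_pos | exact Hw].
    - rewrite geoline_0.
      replace (proj (ray O V s)) with (geoline O V 1 s) by (unfold geoline; now rewrite Rmult_1_l).
      apply Halt; unfold s; lra.
    - rewrite HD; eapply (triangle_exterior a b c); try assumption.
      + rewrite mink_geoline, Rmult_1_l by apply HFM.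
        now apply transversal_coords.
      + now apply half_width_outside. }
  (* L/2 <= rho, so the altitude stays inside up to this time. *)
  destruct (barrier_path theta D F (geoline O V 1) (L / 2) HBar (geoline_geodesic O V 1 HF)
     (fun t => velocity_neq_0 O V t HF)) as [SC SB].
  { intros t Ht; apply Halt; lra. }
  assert (Hth : 0 <= theta) by apply HBar.
  pose proof (sc_path_barrier (L / 2) _ _ theta s Hth SC SB ltac:(unfold s; lra)) as HS.
  assert (S0 : 0 <= slope F (geoline O V 1) 0).
  { unfold slope; rewrite velocity_geoline_0, geoline_0 by exact HF; exact Hgrad. }
  pose proof (log_hess_growth theta D F O V M s HBar HF OM VM MM ltac:(lra)
     ltac:(intros t Ht; apply Halt; unfold s in *; lra)) as HG.
  assert (HpD : forall t, 0 <= t < rho -> 0 < hess_frame F (ray O V t) M).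
  { intros t Ht; rewrite <- hess_along_0 by apply HFM.
    apply HBar; [|apply velocity_neq_0, HFM].
    rewrite geoline_0.
    replace (proj (ray O V t)) with (geoline O V 1 t) by (unfold geoline; now rewrite Rmult_1_l).
    now apply Halt. }
  pose proof (HpD 0 ltac:(lra)) as Hk0; rewrite ray_0 in Hk0.
  pose proof (HpD s ltac:(unfold s; lra)) as Hks.
  set (k0 := hess_frame F O M) in *; set (ks := hess_frame F (ray O V s) M) in *.
  pose proof (sqrt_lt_R0 _ Hk0) as Q0; pose proof (sqrt_lt_R0 _ Hks) as Qs.
  pose proof (sqrt_sqrt k0 ltac:(lra)) as E0; pose proof (sqrt_sqrt ks ltac:(lra)) as Es.
  set (Q := theta + 2 * sqrt theta) in *.
  assert (HQ0 : 0 < Q) by (apply Rlt_le_trans with (w * sqrt k0); [now apply Rmult_lt_0_compat | exact HQ]).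
  (* The logarithm of e^s sqrt k0 <= Q sqrt ks, the product of [HX] and [HQ] with w cancelled. *)
  assert (Hln : s + ln (sqrt k0) <= ln Q + ln (sqrt ks)).
  { rewrite <- (ln_exp s) at 1.
    rewrite <- !ln_mult by (try apply exp_pos; assumption).
    apply ln_le; [apply Rmult_lt_0_compat; [apply exp_pos | exact Q0]|].
    pose proof (exp_pos s) as Hes.
    assert (Hes' : exp s * exp (- s) = 1) by (rewrite <- exp_plus, Rplus_opp_r; apply exp_0).
    assert (K : exp s <= w * sqrt ks).
    { replace (w * sqrt ks) with (exp s * (exp (- s) * w * sqrt ks))
        by (transitivity (exp s * exp (- s) * (w * sqrt ks)); [ring | rewrite Hes'; ring]).
      rewrite <- (Rmult_1_r (exp s)) at 1; apply Rmult_le_compat_l; lra. }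
    apply Rle_trans with (w * sqrt ks * sqrt k0); [apply Rmult_le_compat_r; lra|].
    replace (w * sqrt ks * sqrt k0) with (w * sqrt k0 * sqrt ks) by ring.
    apply Rmult_le_compat_r; lra. }
  assert (Hl0 : ln k0 = 2 * ln (sqrt k0)) by (rewrite <- E0 at 1; rewrite ln_mult by exact Q0; ring).
  assert (Hls : ln ks = 2 * ln (sqrt ks)) by (rewrite <- Es at 1; rewrite ln_mult by exact Qs; ring).
  (* Doubling [Hln] gives ln ks - ln k0 >= 2 s - 2 ln Q, while [HG] and [S0] bound it by the slope
     at s plus s. *)
  apply (final_estimate theta L (slope F (geoline O V 1) s)); try assumption.
  fold s Q; lra.
Qed.

Theorem theorem1p1 (L : R) (L_pos : 0 < L)
  (a b c : R * R) (Ha : H2 a) (Hb : H2 b) (Hc : H2 c)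
  (Hab : hdist a b = L) (Hbc : hdist b c = L) (Hca : hdist c a = L)
  (theta : R) (F : R * R -> R)
  (HF : is_barrier theta (set_interior (geod_triangle a b c)) F) :
  theta >= L / 12 - 1 / 6.
Proof.
  apply Rle_ge.
  destruct (hdist_polar a b Ha Hb) as [_ Eab]; rewrite Hab in Eab; symmetry in Eab.
  destruct (hdist_polar b c Hb Hc) as [_ Ebc]; rewrite Hbc in Ebc; symmetry in Ebc.
  destruct (hdist_polar c a Hc Ha) as [_ Eca]; rewrite Hca in Eca; symmetry in Eca.
  assert (Hk : 1 < cosh L).
  { rewrite cosh_double; pose proof (sinh_pos (L / 2) ltac:(lra)); nra. }
  set (O := center (cosh L) (mink a) (mink b) (mink c)).
  set (g := fun X => ginner (proj O) (grad F (proj O))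
                       (dproj (proj O) (frame_dir O X (circumradius (cosh L))))).
  assert (E1 : O = center (cosh L) (mink b) (mink c) (mink a))
    by (unfold O, center, lin; cbn [cu cv cw]; f_equal; ring).
  assert (E2 : O = center (cosh L) (mink c) (mink a) (mink b))
    by (unfold O, center, lin; cbn [cu cv cw]; f_equal; ring).
  (* The three directions from the center to the vertices add up to zero. *)
  assert (Hsum : g (mink a) + g (mink b) + g (mink c) = 0).
  { destruct (rho_pos _ Hk) as (_ & Hr & Cr); destruct (n_pos _ Hk) as [Hn _].
    set (r := circumradius (cosh L)) in *.
    set (S := lin (/ sinh r) (mink a) (/ sinh r) (lin 1 (mink b) 1 (mink c))).
    (* The sum of the three unit directions; it is zero because A + B + C = n O with n = 3 cosh
       r. *)
    set (T := lin 1 S (- (3 * (cosh r / sinh r))) O).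
    assert (ET : T = Vec 0 0 0).
    { unfold T, S, O, center, lin; cbn [cu cv cw]; rewrite Cr; f_equal; field; lra. }
    transitivity (ginner (proj O) (grad F (proj O)) (dproj (proj O) T)).
    - unfold g, T, S, frame_dir, ginner, sum2, dproj, lin; cbn [cu cv cw coord fst snd]; ring.
    - rewrite ET; unfold ginner, sum2, dproj; cbn [cu cv cw coord fst snd]; ring. }
  destruct (Rle_lt_dec 0 (g (mink a))) as [Ka | Ka];
    [|destruct (Rle_lt_dec 0 (g (mink b))) as [Kb | Kb]].
  - now apply (vertex_bound theta (set_interior (geod_triangle a b c)) F L a b c).
  - apply (vertex_bound theta (set_interior (geod_triangle a b c)) F L b c a); try assumption.
    + intros z; unfold set_interior; split; apply filter_imp; intros y; [apply triangle_rotate|].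
      intros K; now apply triangle_rotate, triangle_rotate.
    + rewrite <- E1; exact Kb.
  - apply (vertex_bound theta (set_interior (geod_triangle a b c)) F L c a b); try assumption.
    + intros z; unfold set_interior; split; apply filter_imp; intros y; [|apply triangle_rotate].
      intros K; now apply triangle_rotate, triangle_rotate.
    + rewrite <- E2; change (0 <= g (mink c)); lra.
Qed.
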